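(* Let $(\mathcal{C},\mathcal{W},\mathcal{F})$ be a Hovey triple in an exact category $(\mathcal{A},\mathcal{E})$, and let $\mathcal{X}=\mathcal{C}\cap\mathcal{W}\cap\mathcal{F}$. Then (i) $(\mathcal{C},\mathcal{X},\mathcal{F})$ is a localization triple of $\mathcal{A}$; (ii) $(\mathcal{A},0,0,\mathrm{L}(\mathcal{F}),\mathrm{R}(\mathcal{C}),\mathcal{X})$ is a pre-partial triangulated category, where $\mathrm{R}(\mathcal{C})=\{A\xrightarrow{f}B\to C\to 0 \mid A\xrightarrow{f}B\to C\in\mathcal{E},\ C\in\mathcal{C}\}$ and $\mathrm{L}(\mathcal{F})=\{0\to K\to A\xrightarrow{f}B\mid K\to A\xrightarrow{f}B\in\mathcal{E},\ K\in\mathcal{F}\}$.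
   Context: **Conventions.** Subcategories of additive categories are full and closed under isomorphisms; functors between additive categories are additive. If $\mathcal{X}\subseteq\mathcal{C}$ are additive (sub)categories, the stable category $\mathcal{C}/\mathcal{X}$ has the objects of $\mathcal{C}$ and $\mathrm{Hom}_{\mathcal{C}/\mathcal{X}}(A,B)=\mathrm{Hom}_{\mathcal{C}}(A,B)/\mathcal{X}(A,B)$, where $\mathcal{X}(A,B)$ is the subgroup of morphisms factoring through an object of $\mathcal{X}$; $\underline{f}$ is the class of $f$. In an additive category $\mathcal{A}$ with additive subcategory $\mathcal{X}$: $f:A\to B$ is an $\mathcal{X}$-monic if $\mathrm{Hom}(B,X)\to\mathrm{Hom}(A,X)$ is surjective for all $X\in\mathcal{X}$, and an $\mathcal{X}$-preenvelope if moreover $B\in\mathcal{X}$; dually, $\mathcal{X}$-epic and $\mathcal{X}$-precover. $g:B\to C$ is a weak cokernel of $f:A\to B$ if $\mathrm{Hom}(C,M)\to\mathrm{Hom}(B,M)\to\mathrm{Hom}(A,M)$ is exact for all $M\in\mathcal{A}$; weak kernels are dual. **Hovey triples.** $(\mathcal{A},\mathcal{E})$ is an exact category in the sense of Quillen; the members of $\mathcal{E}$ are called conflations. A cotorsion pair is a pair $(\mathcal{C},\mathcal{F})$ of classes of objects with $\mathcal{C}=\{C\mid\mathrm{Ext}^1_{\mathcal{A}}(C,\mathcal{F})=0\}$ and $\mathcal{F}=\{F\mid\mathrm{Ext}^1_{\mathcal{A}}(\mathcal{C},F)=0\}$ (Yoneda Ext); it is complete if for each $A\in\mathcal{A}$ there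 are conflations $F\to C\to A$ and $A\to F'\to C'$ with $C,C'\in\mathcal{C}$, $F,F'\in\mathcal{F}$. A Hovey triple is a triple $(\mathcal{C},\mathcal{W},\mathcal{F})$ of classes of objects such that $\mathcal{W}$ is a thick subcategory (closed under direct summands, and if two of the three terms of a conflation are in $\mathcal{W}$ so is the third) and $(\mathcal{C},\mathcal{W}\cap\mathcal{F})$ and $(\mathcal{C}\cap\mathcal{W},\mathcal{F})$ are complete cotorsion pairs. **Localization triple.** For additive subcategories $\mathcal{C},\mathcal{D},\mathcal{X}$ of an additive category $\mathcal{A}$ with $\mathcal{X}\subseteq\mathcal{C}\cap\mathcal{D}$ put $\mathcal{C}^{\perp_{\mathcal{A}/\mathcal{X}}}=\{W\in\mathcal{A}\mid\mathrm{Hom}_{\mathcal{A}/\mathcal{X}}(\mathcal{C},W)=0\}$ and ${}^{\perp_{\mathcal{A}/\mathcal{X}}}\mathcal{D}=\{W\in\mathcal{A}\mid\mathrm{Hom}_{\mathcal{A}/\mathcal{X}}(W,\mathcal{D})=0\}$. $(\mathcal{C},\mathcal{X},\mathcal{D})$ is a localization triple of $\mathcal{A}$ if (a) for each $A\in\mathcal{A}$ there is a fixed sequence $W_A\xrightarrow{\omega_A}Q(A)\xrightarrow{r_A}A$ with $r_A$ a $\mathcal{C}$-precover, $\omega_A$ a weak kernel of $r_A$ and $W_A\in\mathcal{C}^{\perp_{\mathcal{A}/\mathcal{X}}}$; (b) for each $A\in\mathcal{A}$ there is a fixed sequence $A\xrightarrow{j^A}R(A)\xrightarrow{\tau^A}W^A$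 with $j^A$ a $\mathcal{D}$-preenvelope, $\tau^A$ a weak cokernel of $j^A$ and $W^A\in{}^{\perp_{\mathcal{A}/\mathcal{X}}}\mathcal{D}$; (c) if $A\in\mathcal{D}$ then $Q(A)\in\mathcal{C}\cap\mathcal{D}$, and if $A\in\mathcal{C}$ then $R(A)\in\mathcal{C}\cap\mathcal{D}$. **Partial right/left triangulated categories.** Let $\Sigma:\mathcal{A}\to\mathcal{A}$ be an additive endofunctor and $\mathcal{X}\subseteq\mathcal{C}$ additive subcategories of $\mathcal{A}$. A right $\Sigma$-sequence is $A\to B\to C\to\Sigma(A)$; morphisms of such are commutative ladders $(\alpha,\beta,\gamma,\Sigma(\alpha))$. A right $\mathcal{C}$-sequence is a right $\Sigma$-sequence $A\xrightarrow{f}B\xrightarrow{g}C\xrightarrow{h}\Sigma(A)$ with $C\in\mathcal{C}$, $g$ a weak cokernel of $f$, $h$ a weak cokernel of $g$. $(\mathcal{A},\Sigma,\mathrm{R}(\mathcal{C}),\mathcal{X})$, with $\mathrm{R}(\mathcal{C})$ a class of right $\mathcal{C}$-sequences (right $\mathcal{C}$-triangles) closed under isomorphisms and finite direct sums, is partial right triangulated if: (PRT1)(i) for each $A\in\mathcal{C}$ there is a right $\mathcal{C}$-triangle $A\xrightarrow{i}X\to U\to\Sigma(A)$ with $i$ an $\mathcal{X}$-preenvelope; (ii) for each $f:A\to B$ in $\mathcal{C}$, $A\xrightarrow{\binom{1}{f}}A\oplus B\xrightarrow{(f,-1)}B\xrightarrow{0}\Sigma(A)$ is in $\mathrm{R}(\mathcal{C})$;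 (iii) if $A\xrightarrow{i}X\to U\to\Sigma(A)$ is in $\mathrm{R}(\mathcal{C})$ with $i$ an $\mathcal{X}$-preenvelope in $\mathcal{C}$, then for any $f:A\to B$ in $\mathcal{C}$ there is a right $\mathcal{C}$-triangle $A\xrightarrow{\binom{i}{f}}X\oplus B\to N\to\Sigma(A)$; (PRT2) for any morphism $(\alpha,\beta,\gamma,\Sigma(\alpha))$ of right $\mathcal{C}$-triangles from $A\xrightarrow{f}B\to C\to\Sigma(A)$ to $A'\to X\xrightarrow{s}U\to\Sigma(A')$ with $X\in\mathcal{X}$, if $\alpha$ factors through $f$ then $\gamma$ factors through $s$; (PRT3) given two right $\mathcal{C}$-triangles with first maps $f:A\to B$, $f':A'\to B'$ and $\alpha,\beta$ with $\beta f=f'\alpha$, there is $\gamma$ making $(\alpha,\beta,\gamma,\Sigma(\alpha))$ a morphism; (PRT4) for right $\mathcal{C}$-triangles $A\xrightarrow{f}B\xrightarrow{l}C'\xrightarrow{m}\Sigma(A)$, $B\xrightarrow{g}C\xrightarrow{h}A'\xrightarrow{j}\Sigma(B)$, $A\xrightarrow{gf}C\xrightarrow{u}B'\xrightarrow{v}\Sigma(A)$ with $f,g$ $\mathcal{X}$-monics in $\mathcal{C}$, there are $r:C'\to B'$, $s:B'\to A'$ with $rl=ug$, $vr=m$, $su=h$, $js=\Sigma(f)v$, such that $C'\xrightarrow{r}B'\xrightarrow{s}A'\xrightarrow{\Sigma(l)j}\Sigma(C')$ is in $\mathrm{R}(\mathcal{C})$ and $r$ is an $\mathcal{X}$-monic.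 Dually, $(\mathcal{A},\Omega,\mathrm{L}(\mathcal{F}),\mathcal{X})$, with $\mathcal{X}\subseteq\mathcal{F}$ and $\mathrm{L}(\mathcal{F})$ a class of left $\mathcal{F}$-sequences (left $\mathcal{F}$-triangles) $\Omega(B)\xrightarrow{u}K\xrightarrow{v}A\xrightarrow{f}B$ ($K\in\mathcal{F}$, $v$ a weak kernel of $f$, $u$ a weak kernel of $v$), is partial left triangulated if the opposite data are partial right triangulated. **Induced structures.** For a partial right triangulated category fix for each $A\in\mathcal{C}$ a right $\mathcal{C}$-triangle $A\xrightarrow{i^A}X^A\xrightarrow{p^A}U^A\xrightarrow{q^A}\Sigma(A)$ with $i^A$ an $\mathcal{X}$-preenvelope. $\Sigma^{\mathcal{X}}:\mathcal{C}/\mathcal{X}\to\mathcal{C}/\mathcal{X}$ is the (well-defined) functor $A\mapsto U^A$, $\underline{f}\mapsto\underline{\kappa^f}$ for $f:A\to B$, where $\sigma^f i^A=i^Bf$, $\kappa^fp^A=p^B\sigma^f$, $q^B\kappa^f=\Sigma(f)q^A$. $\Delta^{\mathcal{X}}$ is the class of right $\Sigma^{\mathcal{X}}$-sequences in $\mathcal{C}/\mathcal{X}$ isomorphic to $A\xrightarrow{\underline f}B\xrightarrow{\underline g}C\xrightarrow{\underline{\xi}}\Sigma^{\mathcal{X}}(A)$, where $A\xrightarrow{f}B\xrightarrow{g}C\xrightarrow{h}\Sigma(A)$ is a right $\mathcal{C}$-triangle with $f$ an $\mathcal{X}$-monic in $\mathcal{C}$ and $\xi:C\to U^A$ satisfies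 $\delta f=i^A$, $\xi g=p^A\delta$, $q^A\xi=h$ for some $\delta:B\to X^A$. Dually fix left $\mathcal{F}$-triangles $\Omega(A)\xrightarrow{\nu_A}U_A\xrightarrow{\iota_A}X_A\xrightarrow{\pi_A}A$ with $\pi_A$ an $\mathcal{X}$-precover for $A\in\mathcal{F}$, giving $\Omega_{\mathcal{X}}:\mathcal{F}/\mathcal{X}\to\mathcal{F}/\mathcal{X}$, $A\mapsto U_A$, and $\nabla_{\mathcal{X}}$, the class of left $\Omega_{\mathcal{X}}$-sequences isomorphic to $\Omega_{\mathcal{X}}(B)\xrightarrow{\underline\zeta}K\xrightarrow{\underline v}A\xrightarrow{\underline f}B$ for left $\mathcal{F}$-triangles $\Omega(B)\xrightarrow{u}K\xrightarrow{v}A\xrightarrow{f}B$ with $f$ an $\mathcal{X}$-epic in $\mathcal{F}$, where $f\delta=\pi_B$, $v\zeta=\delta\iota_B$, $\zeta\nu_B=u$ for some $\delta:X_B\to A$. **Stabilizing subcategories.** Let $\mathcal{X}\subseteq\mathcal{G}\subseteq\mathcal{C}$ be additive. $\mathcal{G}$ is special preenveloping in $\mathcal{C}$ if each $A\in\mathcal{C}$ has a (fixed) right $\mathcal{C}$-triangle $A\xrightarrow{j^A}R(A)\to W^A\to\Sigma(A)$ with $j^A$ a $\mathcal{G}$-preenvelope and $\mathrm{Hom}_{\mathcal{C}/\mathcal{X}}(W^A,\mathcal{G})=0$. For $f:A\to B$ in $\mathcal{C}$ choose $\hat f:R(A)\to R(B)$ with $\hat fj^A=j^Bf$; $\underline f\mapsto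 R(\underline f)=\underline{\hat f}$ defines a functor $R:\mathcal{C}/\mathcal{X}\to\mathcal{G}/\mathcal{X}$. $\mathcal{G}$ is stabilizing in $(\mathcal{A},\Sigma,\mathrm{R}(\mathcal{C}),\mathcal{X})$ if it is special preenveloping in $\mathcal{C}$ and for each $f:A\to B$ in $\mathcal{C}$ and all $A\xrightarrow{\underline f}B\to C\to\Sigma^{\mathcal{X}}(A)$ and $R(A)\xrightarrow{\underline{\hat f}}R(B)\to D\to\Sigma^{\mathcal{X}}(R(A))$ in $\Delta^{\mathcal{X}}$ there is $\underline t:C\to D$ making $(\underline{j}^A,\underline{j}^B,\underline t,\Sigma^{\mathcal{X}}(\underline{j}^A))$ a morphism of sequences with $R(\underline t)$ an isomorphism. Dually, $\mathcal{G}$ with $\mathcal{X}\subseteq\mathcal{G}\subseteq\mathcal{F}$ is special precovering in $\mathcal{F}$ if each $A\in\mathcal{F}$ has a (fixed) left $\mathcal{F}$-triangle $\Omega(A)\to W_A\to Q(A)\xrightarrow{r_A}A$ with $r_A$ a $\mathcal{G}$-precover and $\mathrm{Hom}_{\mathcal{F}/\mathcal{X}}(\mathcal{G},W_A)=0$; then $Q(\underline f)=\underline{\check f}$ with $r_B\check f=fr_A$ defines a functor $Q:\mathcal{F}/\mathcal{X}\to\mathcal{G}/\mathcal{X}$, and $\mathcal{G}$ is stabilizing in $(\mathcal{A},\Omega,\mathrm{L}(\mathcal{F}),\mathcal{X})$ if moreover for all $\Omega_{\mathcal{X}}(Q(B))\to K\to Q(A)\xrightarrow{\underline{\check f}}Q(B)$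 and $\Omega_{\mathcal{X}}(B)\to L\to A\xrightarrow{\underline f}B$ in $\nabla_{\mathcal{X}}$ there is $\underline s:K\to L$ making $(\Omega_{\mathcal{X}}(\underline r_B),\underline s,\underline r_A,\underline r_B)$ a morphism with $Q(\underline s)$ an isomorphism. **Pre-partial triangulated category.** $(\mathcal{A},\Omega,\Sigma,\mathrm{L}(\mathcal{F}),\mathrm{R}(\mathcal{C}),\mathcal{X})$ where $(\mathcal{A},\Sigma,\mathrm{R}(\mathcal{C}),\mathcal{X})$ is partial right triangulated, $(\mathcal{A},\Omega,\mathrm{L}(\mathcal{F}),\mathcal{X})$ is partial left triangulated, and: (a) $\Omega$ is left adjoint to $\Sigma$, with adjunction isomorphism $\psi_{C,A}:\mathrm{Hom}(\Omega(C),A)\to\mathrm{Hom}(C,\Sigma(A))$. (b) $\mathcal{C}\cap\mathcal{F}$ is stabilizing in both $(\mathcal{A},\Sigma,\mathrm{R}(\mathcal{C}),\mathcal{X})$ and $(\mathcal{A},\Omega,\mathrm{L}(\mathcal{F}),\mathcal{X})$. (c) Given a right $\mathcal{C}$-triangle $A\xrightarrow{f}B\xrightarrow{g}C\xrightarrow{h}\Sigma(A)$ with $f$ an $\mathcal{X}$-monic, a left $\mathcal{F}$-triangle $\Omega(N)\xrightarrow{u}L\xrightarrow{v}M\xrightarrow{w}N$ with $w$ an $\mathcal{X}$-epic, and $\beta:B\to M$: (i) if $\gamma:C\to N$ satisfies $\gamma g=w\beta$, there is $\alpha:A\to L$ with $v\alpha=\beta f$ and $u\Omega(\gamma)=-\alpha\psi^{-1}_{C,A}(h)$;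 (ii) if $\alpha:A\to L$ satisfies $v\alpha=\beta f$, there is $\gamma:C\to N$ with $\gamma g=w\beta$ and $\Sigma(\alpha)h=-\psi_{N,L}(u)\gamma$. (d) Let $A\in\mathcal{C}\cap\mathcal{F}$ with its fixed right $\mathcal{C}$-triangle $A\xrightarrow{i^A}X^A\xrightarrow{p^A}U^A\xrightarrow{q^A}\Sigma(A)$, let $\Omega(N)\xrightarrow{u}L\xrightarrow{v}M\xrightarrow{w}N$ be in $\mathrm{L}(\mathcal{F})$ with $w$ an $\mathcal{X}$-epic, and let $\alpha:A\to L$, $\beta:X^A\to M$, $\gamma:U^A\to N$ satisfy $v\alpha=\beta i^A$, $w\beta=\gamma p^A$, $u\Omega(\gamma)=-\alpha\psi^{-1}_{U^A,A}(q^A)$. If $\gamma$ factors through $w$, then $\alpha$ factors through $i^A$. (e) Let $D\in\mathcal{C}\cap\mathcal{F}$ with its fixed left $\mathcal{F}$-triangle $\Omega(D)\xrightarrow{\nu_D}U_D\xrightarrow{\iota_D}X_D\xrightarrow{\pi_D}D$, let $A\xrightarrow{f}B\xrightarrow{g}C\xrightarrow{h}\Sigma(A)$ be in $\mathrm{R}(\mathcal{C})$ with $f$ an $\mathcal{X}$-monic, and let $\alpha:A\to U_D$, $\beta:B\to X_D$, $\gamma:C\to D$ satisfy $\iota_D\alpha=\beta f$, $\pi_D\beta=\gamma g$, $\Sigma(\alpha)h=-\psi_{D,U_D}(\nu_D)\gamma$. If $\alpha$ factors through $f$, then $\gamma$ factors through $\pi_D$. *)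

(* Defs.v *)
From mathcomp Require Import all_boot all_algebra.
From mathcomp Require Import classical_sets.

Set Implicit Arguments.
Unset Strict Implicit.
Unset Printing Implicit Defensive.

Import GRing.Theory.
Local Open Scope ring_scope.
Local Open Scope classical_set_scope.

(* Taking [hom] in [zmodType] loses no generality: classically, every abelian
   group has decidable equality and a choice operator.  Likewise the zero object
   and the biproducts are chosen; all notions below are invariant under
   isomorphism.  The equation [idm zob = 0] says that [zob] is a zero object. *)
Record addCat := AddCat {
  ob : Type;
  hom : ob -> ob -> zmodType;
  idm : forall A, hom A A;
  comp : forall A B C, hom B C -> hom A B -> hom A C;
  comp1m : forall A B (f : hom A B), comp (idm B) f = f;
  compm1 : forall A B (f : hom A B), comp f (idm A) = f;
  compA : forall A B C D (h : hom C D) (g : hom B C) (f : hom A B),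
    comp h (comp g f) = comp (comp h g) f;
  compDl : forall A B C (g g' : hom B C) (f : hom A B),
    comp (g + g') f = comp g f + comp g' f;
  compDr : forall A B C (g : hom B C) (f f' : hom A B),
    comp g (f + f') = comp g f + comp g f';
  zob : ob;
  idm_zob : idm zob = 0;
  bip : ob -> ob -> ob;
  in1 : forall A B, hom A (bip A B);
  in2 : forall A B, hom B (bip A B);
  pr1 : forall A B, hom (bip A B) A;
  pr2 : forall A B, hom (bip A B) B;
  pr1_in1 : forall A B, comp (pr1 A B) (in1 A B) = idm A;
  pr2_in2 : forall A B, comp (pr2 A B) (in2 A B) = idm B;
  pr2_in1 : forall A B, comp (pr2 A B) (in1 A B) = 0;
  pr1_in2 : forall A B, comp (pr1 A B) (in2 A B) = 0;
  bip_id : forall A B,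
    comp (in1 A B) (pr1 A B) + comp (in2 A B) (pr2 A B) = idm (bip A B)
}.

Arguments hom {a} _ _.
Arguments idm {a} _.
Arguments comp {a A B C} _ _.
Arguments zob a : clear implicits.
Arguments bip {a} _ _.
Arguments in1 {a} _ _.
Arguments in2 {a} _ _.
Arguments pr1 {a} _ _.
Arguments pr2 {a} _ _.

Notation "g \oc f" := (comp g f) (at level 40, left associativity).
Notation "A (+) B" := (bip A B) (at level 50, left associativity).

Definition op (A : addCat) : addCat := {|
  ob := ob A;
  hom := fun M N => @hom A N M;
  idm := @idm A;
  comp := fun M N P g f => f \oc g;
  comp1m := fun M N f => compm1 f;
  compm1 := fun M N f => comp1m f;
  compA := fun M N P Q h g f => esym (compA f g h);
  compDl := fun M N P g g' f => compDr f g g';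
  compDr := fun M N P g f f' => compDl f f' g;
  zob := zob A;
  idm_zob := idm_zob A;
  bip := @bip A;
  in1 := @pr1 A;
  in2 := @pr2 A;
  pr1 := @in1 A;
  pr2 := @in2 A;
  pr1_in1 := @pr1_in1 A;
  pr2_in2 := @pr2_in2 A;
  pr2_in1 := @pr1_in2 A;
  pr1_in2 := @pr2_in1 A;
  bip_id := @bip_id A |}.

Record addFunctor (A B : addCat) := AddFunctor {
  fob :> ob A -> ob B;
  fmap : forall M N, hom M N -> hom (fob M) (fob N);
  fmap_id : forall M, fmap (idm M) = idm (fob M);
  fmap_comp : forall M N P (g : hom N P) (f : hom M N),
    fmap (g \oc f) = fmap g \oc fmap f;
  fmap_add : forall M N (f g : hom M N), fmap (f + g) = fmap f + fmap g
}.

Arguments fmap {A B} _ {M N} _.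

Definition opF (A B : addCat) (T : addFunctor A B) : addFunctor (op A) (op B) :=
  @AddFunctor (op A) (op B) (fun M => T M) (fun M N f => @fmap _ _ T N M f)
    (fun M => fmap_id T M)
    (fun M N P g f => fmap_comp T f g)
    (fun M N f g => fmap_add T f g).

Lemma comp0m (A : addCat) (M N P : ob A) (f : hom M N) :
  (0 : hom N P) \oc f = 0.
Proof. by apply: (addrI (0 \oc f)); rewrite -compDl !addr0. Qed.

Lemma compBl (A : addCat) (M N P : ob A) (g g' : hom N P) (f : hom M N) :
  (g - g') \oc f = g \oc f - g' \oc f.
Proof. by apply: (addIr (g' \oc f)); rewrite -compDl !subrK. Qed.

Lemma compBr (A : addCat) (M N P : ob A) (g : hom N P) (f f' : hom M N) :
  g \oc (f - f') = g \oc f - g \oc f'.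
Proof. by apply: (addIr (g \oc f')); rewrite -compDr !subrK. Qed.

Lemma fmapB (A B : addCat) (T : addFunctor A B) (M N : ob A) (f g : hom M N) :
  fmap T (f - g) = fmap T f - fmap T g.
Proof. by apply: (addIr (fmap T g)); rewrite -fmap_add !subrK. Qed.

Definition zeroF (A : addCat) : addFunctor A A :=
  @AddFunctor A A (fun _ => zob A) (fun _ _ _ => 0)
    (fun _ => esym (idm_zob A))
    (fun _ _ _ _ _ => esym (comp0m _ _))
    (fun _ _ _ _ => esym (addr0 0)).

Section Elementary.
Variable A : addCat.
Implicit Types (M N P : ob A) (X G : set (ob A)).

Definition is_iso M N (f : hom M N) :=
  exists g : hom N M, g \oc f = idm M /\ f \oc g = idm N.

Definition additive_subcat X :=
  [/\ X (zob A),
      forall M N, X M -> X N -> X (M (+) N)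
    & forall M N (f : hom M N), is_iso f -> X M -> X N].

(* S is a biproduct of M and some M' *)
Definition direct_summand M S := exists (M' : ob A)
    (i : hom M S) (i' : hom M' S) (p : hom S M) (p' : hom S M'),
  [/\ p \oc i = idm M, p' \oc i' = idm M', p' \oc i = 0, p \oc i' = 0
    & i \oc p + i' \oc p' = idm S].

Definition is_monic_for X M N (f : hom M N) :=
  forall Z, X Z -> forall h : hom M Z, exists h' : hom N Z, h = h' \oc f.

Definition is_epic_for X M N (f : hom M N) :=
  forall Z, X Z -> forall h : hom Z N, exists h' : hom Z M, h = f \oc h'.

Definition preenvelope X M N (f : hom M N) := X N /\ is_monic_for X f.

Definition precover X M N (f : hom M N) := X M /\ is_epic_for X f.

Definition weak_cokernel M N P (f : hom M N) (g : hom N P) :=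
  forall Z (m : hom N Z), m \oc f = 0 <-> exists n : hom P Z, m = n \oc g.

Definition weak_kernel M N P (f : hom M N) (g : hom N P) :=
  forall Z (m : hom Z N), g \oc m = 0 <-> exists n : hom Z M, m = f \oc n.

(* Stable categories.  A morphism of A/X is represented by a morphism of A, and
    [stab_eq X f g] is the equality of the classes of f and g in
    Hom(M, N) / X(M, N); for a subcategory C, the category C/X is the full
    subcategory of A/X on the objects of C. *)

Definition factors_via X M N (f : hom M N) :=
  exists (Z : ob A) (a : hom M Z) (b : hom Z N), X Z /\ f = b \oc a.

Definition stab_eq X M N (f g : hom M N) := factors_via X (f - g).

Definition stab_iso X M N (f : hom M N) :=
  exists g : hom N M, stab_eq X (g \oc f) (idm M) /\ stab_eq X (f \oc g) (idm N).

Definition stab_hom0 X M N := forall f : hom M N, stab_eq X f 0.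

Definition stab_rperp X G : set (ob A) :=
  [set M | forall N, G N -> stab_hom0 X N M].

Definition stab_lperp X G : set (ob A) :=
  [set M | forall N, G N -> stab_hom0 X M N].

Record localization_triple (C X D : set (ob A)) : Prop := {
  lt_addC : additive_subcat C;
  lt_addX : additive_subcat X;
  lt_addD : additive_subcat D;
  lt_sub : X `<=` C `&` D;
  lt_right : exists (Wo Q : ob A -> ob A)
      (w : forall M, hom (Wo M) (Q M)) (r : forall M, hom (Q M) M),
    (forall M, [/\ precover C (r M), weak_kernel (w M) (r M)
                 & stab_rperp X C (Wo M)])
    /\ (forall M, D M -> (C `&` D) (Q M));
  lt_left : exists (R Wo : ob A -> ob A)
      (j : forall M, hom M (R M)) (t : forall M, hom (R M) (Wo M)),
    (forall M, [/\ preenvelope D (j M), weak_cokernel (j M) (t M)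
                 & stab_lperp X D (Wo M)])
    /\ (forall M, C M -> (C `&` D) (R M))
}.

Definition is_kernel M N P (f : hom M N) (g : hom N P) :=
  g \oc f = 0 /\
  forall Z (m : hom Z N), g \oc m = 0 -> exists! n : hom Z M, f \oc n = m.

Definition is_cokernel M N P (f : hom M N) (g : hom N P) :=
  g \oc f = 0 /\
  forall Z (m : hom N Z), m \oc f = 0 -> exists! n : hom P Z, n \oc g = m.

Definition is_pushout M N M' P
    (i : hom M N) (f : hom M M') (f' : hom N P) (i' : hom M' P) :=
  f' \oc i = i' \oc f /\
  forall Z (a : hom N Z) (b : hom M' Z), a \oc i = b \oc f ->
    exists! n : hom P Z, n \oc f' = a /\ n \oc i' = b.

Definition is_pullback P N M' M
    (f' : hom P N) (p' : hom P M') (p : hom N M) (f : hom M' M) :=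
  p \oc f' = f \oc p' /\
  forall Z (a : hom Z N) (b : hom Z M'), p \oc a = f \oc b ->
    exists! n : hom Z P, f' \oc n = a /\ p' \oc n = b.

Definition conflations := forall M N P : ob A, hom M N -> hom N P -> Prop.

Section Exact.
Variable E : conflations.

Definition inflation M N (f : hom M N) := exists (P : ob A) (g : hom N P), E f g.

Definition deflation M N (g : hom M N) := exists (K : ob A) (f : hom K M), E f g.

(* Quillen's axioms, in the reduced form due to Keller and Buehler *)
Record exact_structure : Prop := {
  ex_kercoker : forall M N P (f : hom M N) (g : hom N P),
    E f g -> is_kernel f g /\ is_cokernel f g;
  ex_iso : forall M N P M' N' P' (f : hom M N) (g : hom N P)
      (f' : hom M' N') (g' : hom N' P')
      (a : hom M M') (b : hom N N') (c : hom P P'),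
    is_iso a -> is_iso b -> is_iso c ->
    b \oc f = f' \oc a -> c \oc g = g' \oc b -> E f g -> E f' g';
  ex_infl_id : forall M, inflation (idm M);
  ex_defl_id : forall M, deflation (idm M);
  ex_infl_comp : forall M N P (f : hom M N) (g : hom N P),
    inflation f -> inflation g -> inflation (g \oc f);
  ex_defl_comp : forall M N P (f : hom M N) (g : hom N P),
    deflation f -> deflation g -> deflation (g \oc f);
  ex_pushout : forall M N M' (i : hom M N) (f : hom M M'), inflation i ->
    exists (P : ob A) (f' : hom N P) (i' : hom M' P),
      is_pushout i f f' i' /\ inflation i';
  ex_pullback : forall N M M' (p : hom N M) (f : hom M' M), deflation p ->
    exists (P : ob A) (f' : hom P N) (p' : hom P M'),
      is_pullback f' p' p f /\ deflation p'
}.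

Definition yoneda_equiv M N N' P (f : hom M N) (g : hom N P)
    (f' : hom M N') (g' : hom N' P) :=
  exists b : hom N N', b \oc f = f' /\ g' \oc b = g.

(* Ext^1(P, M) = 0: every extension of P by M is Yoneda equivalent to the split
   one, which is the zero of the Baer sum *)
Definition Ext1_zero P M := forall N (f : hom M N) (g : hom N P),
  E f g -> yoneda_equiv f g (in1 M P) (pr2 M P).

Definition cotorsion_pair (C F : set (ob A)) :=
  C = [set M | forall N, F N -> Ext1_zero M N] /\
  F = [set N | forall M, C M -> Ext1_zero M N].

Definition complete_cotorsion_pair (C F : set (ob A)) :=
  [/\ cotorsion_pair C F,
      forall M, exists (K Q : ob A) (i : hom K Q) (p : hom Q M),
        [/\ E i p, F K & C Q]
    & forall M, exists (R Q : ob A) (i : hom M R) (p : hom R Q),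
        [/\ E i p, F R & C Q]].

Record thick (W : set (ob A)) : Prop := {
  thick_summand : forall M S, direct_summand M S -> W S -> W M;
  thick_left : forall M N P (f : hom M N) (g : hom N P),
    E f g -> W N -> W P -> W M;
  thick_mid : forall M N P (f : hom M N) (g : hom N P),
    E f g -> W M -> W P -> W N;
  thick_right : forall M N P (f : hom M N) (g : hom N P),
    E f g -> W M -> W N -> W P
}.

Definition hovey_triple (C W F : set (ob A)) :=
  [/\ thick W, complete_cotorsion_pair C (W `&` F)
    & complete_cotorsion_pair (C `&` W) F].

End Exact.

(* classes of right S-sequences M --f--> N --g--> P --h--> S M *)
Definition rclass (S : addFunctor A A) :=
  forall M N P : ob A, hom M N -> hom N P -> hom P (S M) -> Prop.

(* classes of left O-sequences O N --u--> K --v--> M --f--> N; the maps are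
   listed from right to left (f, v, u), which makes [lclass O] convertible to
   the type of classes of right sequences of the opposite category *)
Definition lclass (O : addFunctor A A) :=
  forall N M K : ob A, hom M N -> hom K M -> hom (O N) K -> Prop.

End Elementary.

Section PartialRight.
Variables (A : addCat) (S : addFunctor A A) (R : rclass S) (C X : set (ob A)).

Definition right_sequence M N P (f : hom M N) (g : hom N P) (h : hom P (S M)) :=
  [/\ C P, weak_cokernel f g & weak_cokernel g h].

Definition ladder M N P (f : hom M N) (g : hom N P) (h : hom P (S M))
    M' N' P' (f' : hom M' N') (g' : hom N' P') (h' : hom P' (S M'))
    (a : hom M M') (b : hom N N') (c : hom P P') :=
  [/\ b \oc f = f' \oc a, c \oc g = g' \oc b & fmap S a \oc h = h' \oc c].

Definition dsum (M N M' N' : ob A) (f : hom M N) (f' : hom M' N') :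
    hom (M (+) M') (N (+) N') :=
  in1 N N' \oc f \oc pr1 M M' + in2 N N' \oc f' \oc pr2 M M'.

Record partial_right_triangulated : Prop := {
  prt_addC : additive_subcat C;
  prt_addX : additive_subcat X;
  prt_sub : X `<=` C;
  prt_seq : forall M N P (f : hom M N) (g : hom N P) (h : hom P (S M)),
    R f g h -> right_sequence f g h;
  prt_iso : forall M N P (f : hom M N) (g : hom N P) (h : hom P (S M))
      M' N' P' (f' : hom M' N') (g' : hom N' P') (h' : hom P' (S M'))
      (a : hom M M') (b : hom N N') (c : hom P P'),
    is_iso a -> is_iso b -> is_iso c -> ladder f g h f' g' h' a b c ->
    R f g h -> R f' g' h';
  prt_zero : R (0 : hom (zob A) (zob A)) (0 : hom (zob A) (zob A)) 0;
  (* the last map is h (+) h' followed by S M (+) S M' = S (M (+) M') *)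
  prt_sum : forall M N P (f : hom M N) (g : hom N P) (h : hom P (S M))
      M' N' P' (f' : hom M' N') (g' : hom N' P') (h' : hom P' (S M')),
    R f g h -> R f' g' h' ->
    R (dsum f f') (dsum g g')
      (fmap S (in1 M M') \oc h \oc pr1 P P'
       + fmap S (in2 M M') \oc h' \oc pr2 P P');
  PRT1_i : forall M, C M ->
    exists (Z U : ob A) (i : hom M Z) (p : hom Z U) (q : hom U (S M)),
      R i p q /\ preenvelope X i;
  PRT1_ii : forall M N (f : hom M N), C M -> C N ->
    R (in1 M N + in2 M N \oc f) (f \oc pr1 M N - pr2 M N) 0;
  PRT1_iii : forall M Z U (i : hom M Z) (p : hom Z U) (q : hom U (S M)),
    R i p q -> C M -> preenvelope X i ->
    forall N (f : hom M N), C N ->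
    exists (P : ob A) (g : hom (Z (+) N) P) (h : hom P (S M)),
      R (in1 Z N \oc i + in2 Z N \oc f) g h;
  PRT2 : forall M N P (f : hom M N) (g : hom N P) (h : hom P (S M))
      M' Z U (f' : hom M' Z) (s : hom Z U) (h' : hom U (S M'))
      (a : hom M M') (b : hom N Z) (c : hom P U),
    R f g h -> R f' s h' -> X Z -> ladder f g h f' s h' a b c ->
    (exists e : hom N M', a = e \oc f) -> exists e : hom P Z, c = s \oc e;
  PRT3 : forall M N P (f : hom M N) (g : hom N P) (h : hom P (S M))
      M' N' P' (f' : hom M' N') (g' : hom N' P') (h' : hom P' (S M'))
      (a : hom M M') (b : hom N N'),
    R f g h -> R f' g' h' -> b \oc f = f' \oc a ->
    exists c : hom P P', ladder f g h f' g' h' a b c;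
  PRT4 : forall M N P (f : hom M N) (g : hom N P)
      P' (l : hom N P') (m : hom P' (S M))
      M' (h : hom P M') (j : hom M' (S N))
      N' (u : hom P N') (v : hom N' (S M)),
    R f l m -> R g h j -> R (g \oc f) u v ->
    C M -> C N -> C P -> is_monic_for X f -> is_monic_for X g ->
    exists (r : hom P' N') (s : hom N' M'),
      [/\ r \oc l = u \oc g /\ v \oc r = m,
          s \oc u = h /\ j \oc s = fmap S f \oc v,
          R r s (fmap S l \oc j)
        & is_monic_for X r]
}.

(* Induced structure on C/X: a choice of triangles M -> X^M -> U^M -> S M and of
    the lifts kappa^f.  The values of the fields outside C are irrelevant. *)
Record rchoice := RChoice {
  cX : ob A -> ob A;
  cU : ob A -> ob A;
  ci : forall M, hom M (cX M);
  cp : forall M, hom (cX M) (cU M);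
  cq : forall M, hom (cU M) (S M);
  ckappa : forall M N, hom M N -> hom (cU M) (cU N);
  c_tri : forall M, C M -> R (ci M) (cp M) (cq M) /\ preenvelope X (ci M);
  c_kappa : forall M N (f : hom M N), C M -> C N ->
    exists s : hom (cX M) (cX N),
      [/\ s \oc ci M = ci N \oc f, ckappa f \oc cp M = cp N \oc s
        & cq N \oc ckappa f = fmap S f \oc cq M]
}.

(* f |-> kappa^f is a well-defined functor C/X -> C/X *)
Section KappaFunctor.
Variables (HR : partial_right_triangulated) (T : rchoice).

Lemma kappa_factors (M N : ob A) (f : hom M N) (s : hom (cX T M) (cX T N))
    (k : hom (cU T M) (cU T N)) : C M -> C N ->
  s \oc ci T M = ci T N \oc f -> k \oc cp T M = cp T N \oc s ->
  cq T N \oc k = fmap S f \oc cq T M -> factors_via X f -> factors_via X k.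
Proof.
move=> CM CN e1 e2 e3 [Z [a [b [XZ def_f]]]].
have [RM [XM HM]] := c_tri T CM; have [RN [XN _]] := c_tri T CN.
have [|e ->] := PRT2 HR RM RN XN (And3 e1 e2 (esym e3)).
  have [a' def_a] := HM Z XZ a.
  by exists (b \oc a'); rewrite def_f def_a compA.
by exists (cX T N), e, (cp T N).
Qed.

Lemma kappa_stab_eq (M N : ob A) (f g : hom M N) : C M -> C N ->
  stab_eq X f g -> stab_eq X (ckappa T f) (ckappa T g).
Proof.
move=> CM CN; have [s [s1 s2 s3]] := c_kappa T f CM CN.
have [t [t1 t2 t3]] := c_kappa T g CM CN.
apply: (@kappa_factors _ _ _ (s - t)) => //.
- by rewrite compBl compBr s1 t1.
- by rewrite compBl compBr s2 t2.
by rewrite compBr fmapB compBl s3 t3.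
Qed.

Lemma factors_via0 (M N : ob A) : factors_via X (0 : hom M N).
Proof.
by exists (zob A), 0, 0; split; [case: (prt_addX HR) | rewrite comp0m].
Qed.

Lemma kappa_id (M : ob A) : C M -> stab_eq X (ckappa T (idm M)) (idm (cU T M)).
Proof.
move=> CM; have [s [s1 s2 s3]] := c_kappa T (idm M) CM CM.
apply: (@kappa_factors _ _ (idm M - idm M) (s - idm _)) => //.
- by rewrite compBl compBr s1 comp1m !compm1.
- by rewrite compBl compBr s2 comp1m !compm1.
- by rewrite compBr fmapB compBl s3 fmap_id comp1m !compm1.
by rewrite subrr; apply: factors_via0.
Qed.

Lemma kappa_comp (M N P : ob A) (g : hom N P) (f : hom M N) :
  C M -> C N -> C P ->
  stab_eq X (ckappa T (g \oc f)) (ckappa T g \oc ckappa T f).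
Proof.
move=> CM CN CP; have [s [s1 s2 s3]] := c_kappa T (g \oc f) CM CP.
have [t [t1 t2 t3]] := c_kappa T f CM CN.
have [r [r1 r2 r3]] := c_kappa T g CN CP.
apply: (@kappa_factors _ _ (g \oc f - g \oc f) (s - r \oc t)) => //.
- by rewrite compBl compBr s1 -!compA t1 (compA r) r1 -compA.
- by rewrite compBl compBr s2 -!compA t2 (compA (ckappa T g)) r2 -compA.
- rewrite compBr fmapB compBl s3 fmap_comp; congr (_ - _).
  by rewrite compA r3 -compA t3 compA.
by rewrite subrr; apply: factors_via0.
Qed.

End KappaFunctor.

Section Induced.
Variable T : rchoice.

(* morphisms of right sequences of C/X, the endofunctor of C/X being given by
   M |-> U^M and f |-> kappa^f *)
Definition stab_ladder M N P (f : hom M N) (g : hom N P) (x : hom P (cU T M))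
    M' N' P' (f' : hom M' N') (g' : hom N' P') (x' : hom P' (cU T M'))
    (a : hom M M') (b : hom N N') (c : hom P P') :=
  [/\ stab_eq X (b \oc f) (f' \oc a), stab_eq X (c \oc g) (g' \oc b)
    & stab_eq X (ckappa T a \oc x) (x' \oc c)].

Definition std_Delta M N P (f : hom M N) (g : hom N P) (x : hom P (cU T M)) :=
  [/\ C M, C N, is_monic_for X f
    & exists (h : hom P (S M)) (d : hom N (cX T M)),
        [/\ R f g h, d \oc f = ci T M, x \oc g = cp T M \oc d
          & cq T M \oc x = h]].

Definition Delta M N P (f : hom M N) (g : hom N P) (x : hom P (cU T M)) :=
  [/\ C M, C N, C P
    & exists (M' N' P' : ob A)
          (f' : hom M' N') (g' : hom N' P') (x' : hom P' (cU T M'))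
          (a : hom M M') (b : hom N N') (c : hom P P'),
        [/\ std_Delta f' g' x', stab_ladder f g x f' g' x' a b c,
            stab_iso X a, stab_iso X b & stab_iso X c]].

Variable G : set (ob A).

Definition special_tri M N P (j : hom M N) (k : hom N P) (l : hom P (S M)) :=
  [/\ R j k l, preenvelope G j & forall Z, G Z -> stab_hom0 X P Z].

Definition special_preenveloping :=
  forall M, C M -> exists (N P : ob A) (j : hom M N) (k : hom N P)
    (l : hom P (S M)), special_tri j k l.

(* a choice of the triangles M -> R(M) -> W^M -> S M and of the lifts of maps *)
Record special_choice := SpecialChoice {
  sR : ob A -> ob A;
  sW : ob A -> ob A;
  sj : forall M, hom M (sR M);
  sk : forall M, hom (sR M) (sW M);
  sl : forall M, hom (sW M) (S M);
  shat : forall M N, hom M N -> hom (sR M) (sR N);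
  s_tri : forall M, C M -> special_tri (sj M) (sk M) (sl M);
  s_hat : forall M N (f : hom M N), C M -> C N -> shat f \oc sj M = sj N \oc f
}.

Record stabilizing : Prop := {
  stz_addG : additive_subcat G;
  stz_subX : X `<=` G;
  stz_subC : G `<=` C;
  stz_special : special_preenveloping;
  stz_ladder : forall (Y : special_choice) M N (f : hom M N), C M -> C N ->
    forall P (g : hom N P) (x : hom P (cU T M)),
    forall D (g' : hom (sR Y N) D) (x' : hom D (cU T (sR Y M))),
    Delta f g x -> Delta (shat Y f) g' x' ->
    exists t : hom P D,
      stab_ladder f g x (shat Y f) g' x' (sj Y M) (sj Y N) t
      /\ stab_iso X (shat Y t)
}.

End Induced.
End PartialRight.

Arguments stabilizing {A S R C X} T G.

Section PrePartial.
Variables (A : addCat) (O S : addFunctor A A).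
Variables (L : lclass O) (R : rclass S) (F C X : set (ob A)).

Definition partial_left_triangulated :=
  @partial_right_triangulated (op A) (opF O) L F X.

Definition lchoice := @rchoice (op A) (opF O) L F X.

(* the chosen left triangle O D --nu--> U_D --iota--> X_D --pi--> D *)
Definition l_pi (T : lchoice) (D : ob A) : @hom A (cX T D) D := ci T D.
Definition l_iota (T : lchoice) (D : ob A) : @hom A (cU T D) (cX T D) := cp T D.
Definition l_nu (T : lchoice) (D : ob A) : @hom A (O D) (cU T D) := cq T D.

Definition left_stabilizing (T : lchoice) (G : set (ob A)) :=
  @stabilizing (op A) (opF O) L F X T G.

Record adjunction := Adjunction {
  psi : forall M N : ob A, hom (O M) N -> hom M (S N);
  psiV : forall M N : ob A, hom M (S N) -> hom (O M) N;
  psiK : forall M N (f : hom (O M) N), psiV (psi f) = f;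
  psiVK : forall M N (g : hom M (S N)), psi (psiV g) = g;
  psi_nat : forall M M' N N' (a : hom M' M) (b : hom N N') (f : hom (O M) N),
    psi (b \oc f \oc fmap O a) = fmap S b \oc psi f \oc a
}.

Section Compatibility.
Variables (H : adjunction) (TR : rchoice R C X) (TL : lchoice).

Definition PPT_c :=
  forall M N P (f : hom M N) (g : hom N P) (h : hom P (S M))
      K' M' N' (u : hom (O N') K') (v : hom K' M') (w : hom M' N')
      (b : hom N M'),
  R f g h -> is_monic_for X f -> L w v u -> is_epic_for X w ->
  (forall c : hom P N', c \oc g = w \oc b ->
    exists a : hom M K', v \oc a = b \oc f /\
      u \oc fmap O c = - (a \oc psiV H h)) /\
  (forall a : hom M K', v \oc a = b \oc f ->
    exists c : hom P N', c \oc g = w \oc b /\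
      fmap S a \oc h = - (psi H u \oc c)).

Definition PPT_d :=
  forall M, C M -> F M ->
  forall K' M' N' (u : hom (O N') K') (v : hom K' M') (w : hom M' N')
      (a : hom M K') (b : hom (cX TR M) M') (c : hom (cU TR M) N'),
  L w v u -> is_epic_for X w ->
  v \oc a = b \oc ci TR M -> w \oc b = c \oc cp TR M ->
  u \oc fmap O c = - (a \oc psiV H (cq TR M)) ->
  (exists e : hom (cU TR M) M', c = w \oc e) ->
  exists e : hom (cX TR M) K', a = e \oc ci TR M.

Definition PPT_e :=
  forall D, C D -> F D ->
  forall M N P (f : hom M N) (g : hom N P) (h : hom P (S M))
      (a : hom M (cU TL D)) (b : hom N (cX TL D)) (c : hom P D),
  R f g h -> is_monic_for X f ->
  l_iota TL D \oc a = b \oc f -> l_pi TL D \oc b = c \oc g ->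
  fmap S a \oc h = - (psi H (l_nu TL D) \oc c) ->
  (exists e : hom N (cU TL D), a = e \oc f) ->
  exists e : hom P (cX TL D), c = l_pi TL D \oc e.

End Compatibility.

(* The axioms are required for every choice of the triangles defining the
   induced endofunctors; such choices exist by PRT1(i) and PRT3. *)
Record pre_partial_triangulated : Prop := {
  ppt_right : partial_right_triangulated R C X;
  ppt_left : partial_left_triangulated;
  ppt_stab_right : forall TR : rchoice R C X, stabilizing TR (C `&` F);
  ppt_stab_left : forall TL : lchoice, left_stabilizing TL (C `&` F);
  ppt_adj : exists H : adjunction,
    [/\ PPT_c H, forall TR : rchoice R C X, PPT_d H TR
      & forall TL : lchoice, PPT_e H TL]
}.

End PrePartial.

Definition confl_right (A : addCat) (E : conflations A) (C : set (ob A)) :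
    rclass (zeroF A) :=
  fun M N P f g _ => E M N P f g /\ C P.

Definition confl_left (A : addCat) (E : conflations A) (F : set (ob A)) :
    lclass (zeroF A) :=
  fun N M K f v _ => E K M N v f /\ F K.

(* Main.v *)
(** Every part of the statement is self-dual: [(F, W, C)] is a Hovey triple in
    the opposite exact category, so only the right-hand halves need a proof.
    The right triangles are the conflations with cofibrant cokernel, and their
    inflations are automatically [X]-monic because [Ext^1(C, W `&` F) = 0].  The
    essential point is that [C `&` F] is stabilizing.  Call a map [f] a weak
    equivalence if it induces bijections Hom_{A/X}(f, Z) for all fibrant [Z].
    The chosen maps M -> R(M) are weak equivalences, since their cokernels are
    shown to lie in [W]; by a five lemma, a map of conflations which is a weak
    equivalence on the first two terms is one on the third; and between objects
    of [C `&` F] a weak equivalence is invertible in A/X by Yoneda. *)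

From Corelib Require Import Setoid Morphisms.
From mathcomp Require Import all_boot all_algebra.
From mathcomp Require Import boolp classical_sets.
Require Import Defs.

Set Implicit Arguments.
Unset Strict Implicit.
Unset Printing Implicit Defensive.

Import GRing.Theory.
Local Open Scope ring_scope.
Local Open Scope classical_set_scope.

(** * Kernels, cokernels and biproducts in additive categories *)

Section Additive.
Variable A : addCat.
Implicit Types M N P : ob A.

Lemma compm0 M N P (f : hom N P) : f \oc (0 : hom M N) = 0.
Proof. by apply: (addrI (f \oc 0)); rewrite -compDr !addr0. Qed.

Lemma compNm M N P (g : hom N P) (f : hom M N) : (- g) \oc f = - (g \oc f).
Proof. by rewrite -[- g]add0r compBl comp0m add0r. Qed.

Lemma compmN M N P (g : hom N P) (f : hom M N) : g \oc (- f) = - (g \oc f).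
Proof. by rewrite -[- f]add0r compBr compm0 add0r. Qed.

Lemma hom_to_null M Z (f : hom M Z) : idm Z = 0 -> f = 0.
Proof. by move=> Z0; rewrite -[f]comp1m Z0 comp0m. Qed.

Lemma hom_from_null M Z (f : hom Z M) : idm Z = 0 -> f = 0.
Proof. by move=> Z0; rewrite -[f]compm1 Z0 compm0. Qed.

Lemma is_iso_id M : is_iso (idm M).
Proof. by exists (idm M); rewrite comp1m. Qed.

Lemma kernel_mono M N P Z (f : hom M N) (g : hom N P) (m n : hom Z M) :
  is_kernel f g -> f \oc m = f \oc n -> m = n.
Proof.
move=> [gf0 ker_f] e; have [|k [_ uniq_k]] := ker_f Z (f \oc n).
  by rewrite compA gf0 comp0m.
by rewrite -(uniq_k m) // -(uniq_k n).
Qed.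

Lemma kernel_lift M N P Z (f : hom M N) (g : hom N P) (m : hom Z N) :
  is_kernel f g -> g \oc m = 0 -> exists n : hom Z M, m = f \oc n.
Proof. by move=> [_ ker_f] /ker_f [n [<- _]]; exists n. Qed.

Lemma is_kernelP M N P (f : hom M N) (g : hom N P) :
  g \oc f = 0 -> (forall Z (m n : hom Z M), f \oc m = f \oc n -> m = n) ->
  (forall Z (m : hom Z N), g \oc m = 0 -> exists n : hom Z M, m = f \oc n) ->
  is_kernel f g.
Proof.
move=> gf0 mono lift; split=> // Z m /lift [n ->].
by exists n; split=> // n' /mono.
Qed.

Lemma bip_mono M N Z (f g : hom Z (M (+) N)) :
  pr1 M N \oc f = pr1 M N \oc g -> pr2 M N \oc f = pr2 M N \oc g -> f = g.
Proof.
by move=> e1 e2; rewrite -[f]comp1m -[g]comp1m -bip_id !compDl -!compA e1 e2.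
Qed.

End Additive.

Section AdditiveDual.
Variable A : addCat.
Implicit Types M N P : ob A.

Lemma cokernel_epi M N P Z (f : hom M N) (g : hom N P) (m n : hom P Z) :
  is_cokernel f g -> m \oc g = n \oc g -> m = n.
Proof. exact: (@kernel_mono (op A)). Qed.

Lemma cokernel_lift M N P Z (f : hom M N) (g : hom N P) (m : hom N Z) :
  is_cokernel f g -> m \oc f = 0 -> exists n : hom P Z, m = n \oc g.
Proof. exact: (@kernel_lift (op A)). Qed.

Lemma is_cokernelP M N P (f : hom M N) (g : hom N P) :
  g \oc f = 0 -> (forall Z (m n : hom P Z), m \oc g = n \oc g -> m = n) ->
  (forall Z (m : hom N Z), m \oc f = 0 -> exists n : hom P Z, m = n \oc g) ->
  is_cokernel f g.
Proof. exact: (@is_kernelP (op A)). Qed.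

Lemma cokernel_weak M N P (f : hom M N) (g : hom N P) :
  is_cokernel f g -> weak_cokernel f g.
Proof.
move=> cok Z m; split=> [|[n ->]]; first exact: cokernel_lift.
by case: cok => e _; rewrite -compA e compm0.
Qed.

Lemma cokernel_iso M N P Q (f : hom M N) (g : hom N P) (g' : hom N Q) :
  is_cokernel f g -> is_cokernel f g' ->
  exists2 c : hom P Q, is_iso c & c \oc g = g'.
Proof.
move=> Kg Kg'; have [c def_c] := cokernel_lift Kg (proj1 Kg').
have [d def_d] := cokernel_lift Kg' (proj1 Kg).
exists c => //; exists d; split.
  by apply: (cokernel_epi Kg); rewrite -compA -def_c comp1m.
by apply: (cokernel_epi Kg'); rewrite -compA -def_d comp1m.
Qed.

Lemma bip_epi M N Z (f g : hom (M (+) N) Z) :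
  f \oc in1 M N = g \oc in1 M N -> f \oc in2 M N = g \oc in2 M N -> f = g.
Proof. exact: (@bip_mono (op A)). Qed.

End AdditiveDual.

Definition bipE := (compDl, compDr, compBl, compBr, compNm, compmN, comp0m,
  compm0, comp1m, compm1, pr1_in1, pr2_in2, pr1_in2, pr2_in1, addr0, add0r,
  subr0, sub0r, oppr0).

Definition opE (A : addCat) (E : conflations A) : conflations (op A) :=
  fun M N P f g => E P N M g f.

(** * Exact categories *)

Section ExactBasics.
Variables (A : addCat) (E : conflations A) (hE : exact_structure E).
Implicit Types M N P Q : ob A.

Lemma confl_ker M N P (f : hom M N) (g : hom N P) : E f g -> is_kernel f g.
Proof. by case/(ex_kercoker hE). Qed.

Lemma confl_coker M N P (f : hom M N) (g : hom N P) : E f g -> is_cokernel f g.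
Proof. by case/(ex_kercoker hE). Qed.

(** Cokernels are unique up to isomorphism, and [E] is closed under isomorphism. *)
Lemma inflation_confl M N P (f : hom M N) (g : hom N P) :
  inflation E f -> is_cokernel f g -> E f g.
Proof.
move=> [Q [g' Eg']] Kg; have [c Ic def_g] := cokernel_iso (confl_coker Eg') Kg.
apply: (ex_iso hE (is_iso_id M) (is_iso_id N) Ic _ _ Eg') => //.
  by rewrite comp1m compm1.
by rewrite compm1.
Qed.

Lemma exact_op : exact_structure (opE E).
Proof.
split.
- by move=> M N P f g /(ex_kercoker hE) [].
- move=> M N P M' N' P' f g f' g' a b c [a' [a1 a2]] [b' [b1 b2]] [c' [c1 c2]].
  move=> e1 e2 Efg.
  have Ia : @is_iso A _ _ a' by exists a.
  have Ib : @is_iso A _ _ b' by exists b.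
  have Ic : @is_iso A _ _ c' by exists c.
  rewrite /= in a a' a1 a2 b b' b1 b2 c c' c1 c2 f g f' g' e1 e2 Ia Ib Ic Efg *.
  (* Arrows reverse in [op A], so the ladder is run along the inverses [c'], [b'], [a']. *)
  apply: (ex_iso hE Ic Ib Ia) Efg.
    by rewrite -[b' \oc g]compm1 -c1 compA -(compA b') e2 compA b2 comp1m.
  by rewrite -[a' \oc f]compm1 -b1 compA -(compA a') e1 compA a2 comp1m.
- exact: (ex_defl_id hE).
- exact: (ex_infl_id hE).
- by move=> M N P f g If Ig; apply: (ex_defl_comp hE).
- by move=> M N P f g If Ig; apply: (ex_infl_comp hE).
- by move=> M N M' i f; apply: (ex_pullback hE).
- by move=> M N M' i f; apply: (ex_pushout hE).
Qed.

(** Pairing [p] with 0 through the universal property yields [p']; since maps out of [N'] are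
    determined on [f'] and [i'], it is a cokernel of [i']. *)
Lemma pushout_confl M N P M' N' (i : hom M N) (p : hom N P) (f : hom M M')
    (f' : hom N N') (i' : hom M' N') : E i p -> is_pushout i f f' i' ->
  exists2 p' : hom N' P, E i' p' & p' \oc f' = p.
Proof.
move=> Eip po; have Ii : inflation E i by exists P, p.
have [e univ] := po.
have [|p' [[p'f p'i] _]] := univ P p 0.
  by rewrite comp0m; case: (confl_coker Eip).
have mono_n Z (m n : hom N' Z) :
    m \oc f' = n \oc f' -> m \oc i' = n \oc i' -> m = n.
  move=> e1 e2; have [|k [_ uniq_k]] := univ Z (n \oc f') (n \oc i').
    by rewrite -!compA e.
  by rewrite -(uniq_k m) // -(uniq_k n).
exists p' => //; apply: inflation_confl.
  (* The axiom provides only some pushout whose leg is an inflation; the mutually inverse comparison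
     maps [u], [v] carry this over to the given pushout. *)
  have [Q [f1 [i1 [[e1 univ1] [P1 [p1 Ei1]]]]]] := ex_pushout hE f Ii.
  have [u [[uf ui] _]] := univ _ _ _ e1.
  have [v [[vf vi] _]] := univ1 _ _ _ e.
  have uv : u \oc v = idm _.
    have [k [_ uniq_k]] := univ1 _ _ _ e1.
    by rewrite -(uniq_k (u \oc v)) ?(uniq_k (idm _)) ?comp1m // -!compA vf vi.
  have vu : v \oc u = idm N'.
    by apply: mono_n; rewrite -compA (uf, ui) (vf, vi) comp1m.
  exists P1, (p1 \oc u).
  have Iv : is_iso v by exists u.
  apply: (ex_iso hE (is_iso_id M') Iv (is_iso_id P1)) Ei1.
    by rewrite vi compm1.
  by rewrite comp1m -compA uv compm1.
apply: is_cokernelP => // [Z m n|Z m mi].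
  move=> /(congr1 (fun h => h \oc f')); rewrite -!compA p'f.
  exact: (cokernel_epi (confl_coker Eip)).
have [|n def_n] := cokernel_lift (m := m \oc f') (confl_coker Eip).
  by rewrite -compA e compA mi comp0m.
by exists n; apply: mono_n; rewrite -compA (p'f, p'i) ?compm0.
Qed.

Lemma confl_id0 M : E (idm M) (0 : hom M (zob A)).
Proof.
apply: (inflation_confl (ex_infl_id hE M)).
apply: is_cokernelP => [|Z m n _|Z m]; first by rewrite comp0m.
  by rewrite (hom_from_null m) ?(hom_from_null n) ?idm_zob.
by rewrite compm1 => ->; exists 0; rewrite comp0m.
Qed.

End ExactBasics.

Section Exact.
Variables (A : addCat) (E : conflations A) (hE : exact_structure E).
Implicit Types M N P Q : ob A.

Lemma deflation_confl M N P (f : hom M N) (g : hom N P) :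
  deflation E g -> is_kernel f g -> E f g.
Proof. exact: (@inflation_confl (op A) _ (exact_op hE)). Qed.

Lemma pullback_confl K M N M' N' (k : hom K N) (p : hom N M) (f : hom M' M)
    (f' : hom N' N) (p' : hom N' M') : E k p -> is_pullback f' p' p f ->
  exists2 k' : hom K N', E k' p' & f' \oc k' = k.
Proof. exact: (@pushout_confl (op A) _ (exact_op hE)). Qed.

Lemma confl_0id M : E (0 : hom (zob A) M) (idm M).
Proof. exact: (@confl_id0 (op A) _ (exact_op hE)). Qed.

(** The biproduct is the pushout of [0 -> N] along [0 -> M]. *)
Lemma confl_split M N : E (in1 M N) (pr2 M N).
Proof.
have [|p Ep def_p] := @pushout_confl _ _ hE _ _ _ _ (M (+) N) _ _
    (0 : hom _ M) (in2 M N) (in1 M N) (confl_0id N).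
- split=> [|Z a b _]; first by rewrite !compm0.
  exists (b \oc pr1 M N + a \oc pr2 M N); split=> [|n [<- <-]].
    by rewrite !bipE -!compA !bipE.
  by rewrite -!compA addrC -compDr addrC bip_id compm1.
suff -> : pr2 M N = p by [].
by apply: bip_epi; rewrite ?def_p !bipE // (proj1 (confl_coker hE Ep)).
Qed.

Lemma dsum_in1 M N M' N' (f : hom M N) (f' : hom M' N') :
  dsum f f' \oc in1 M M' = in1 N N' \oc f.
Proof. by rewrite /dsum !bipE -!compA !bipE. Qed.

Lemma dsum_in2 M N M' N' (f : hom M N) (f' : hom M' N') :
  dsum f f' \oc in2 M M' = in2 N N' \oc f'.
Proof. by rewrite /dsum !bipE -!compA !bipE. Qed.

Lemma dsum_comp M N P M' N' P' (f : hom M N) (f' : hom M' N')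
    (g : hom N P) (g' : hom N' P') :
  dsum g g' \oc dsum f f' = dsum (g \oc f) (g' \oc f').
Proof.
by apply: bip_epi; rewrite -compA ?dsum_in1 ?dsum_in2 !compA
  ?dsum_in1 ?dsum_in2.
Qed.

(** The map is the pushout of [f] along [in1 M P]. *)
Lemma inflation_dsum1 M N P (f : hom M N) :
  inflation E f -> inflation E (dsum f (idm P)).
Proof.
move=> [Q [g Eg]].
have [|p Ep _] := @pushout_confl _ _ hE _ _ _ _ _ _ _ 
    (in1 M P) (in1 N P) (dsum f (idm P)) Eg; last by exists Q, p.
split=> [|Z a b e]; first by rewrite dsum_in1.
exists (a \oc pr1 N P + b \oc in2 M P \oc pr2 N P); split.
  split; first by rewrite !bipE -!compA !bipE.
  apply: bip_epi; rewrite -!compA ?dsum_in1 ?dsum_in2 !bipE.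
    by rewrite -!compA !(compA _ (in1 N P)) !bipE.
  by rewrite -!compA !bipE.
move=> n [<- <-]; rewrite -(compA n _ (in2 M P)) dsum_in2 compm1 -!compA.
by rewrite -compDr bip_id compm1.
Qed.

Lemma inflation_dsum M N M' N' (f : hom M N) (f' : hom M' N') :
  inflation E f -> inflation E f' -> inflation E (dsum f f').
Proof.
move=> If If'.
have -> : dsum f f' = dsum f (idm _) \oc dsum (idm _) f'.
  by rewrite dsum_comp comp1m compm1.
apply: (ex_infl_comp hE); last exact: inflation_dsum1.
(* The remaining factor [dsum (idm _) f'] is conjugate to [dsum f' (idm M)] under the symmetry
   [sw]. *)
have [Q [p Ep]] := inflation_dsum1 M If'.
pose sw (X Y : ob A) := in1 Y X \oc pr2 X Y + in2 Y X \oc pr1 X Y.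
have sw1 X Y : sw X Y \oc in1 X Y = in2 Y X.
  by rewrite /sw !bipE -!compA !bipE.
have sw2 X Y : sw X Y \oc in2 X Y = in1 Y X.
  by rewrite /sw !bipE -!compA !bipE.
have swK X Y : sw X Y \oc sw Y X = idm _.
  by apply: bip_epi; rewrite -compA ?(sw1, sw2) ?(sw1, sw2) comp1m.
have Isw X Y : is_iso (sw X Y) by exists (sw Y X).
exists Q, (p \oc sw M N').
apply: (ex_iso hE (Isw _ _) (Isw _ _) (is_iso_id Q)) Ep.
  apply: bip_epi.
    by rewrite -!compA dsum_in1 sw1 dsum_in2 compA sw1.
  by rewrite -!compA dsum_in2 sw2 dsum_in1 compA sw2.
by rewrite comp1m -compA swK compm1.
Qed.

Lemma confl_dsum M N P M' N' P' (f : hom M N) (g : hom N P)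
    (f' : hom M' N') (g' : hom N' P') :
  E f g -> E f' g' -> E (dsum f f') (dsum g g').
Proof.
move=> Efg Efg'; apply: (inflation_confl hE).
  by apply: inflation_dsum; [exists P, g | exists P', g'].
have [Kg Kg'] := (confl_coker hE Efg, confl_coker hE Efg').
apply: is_cokernelP => [|Z m n e|Z m e].
- by rewrite dsum_comp (proj1 Kg) (proj1 Kg') /dsum !bipE.
- apply: bip_epi; [apply: (cokernel_epi Kg) | apply: (cokernel_epi Kg')];
  by rewrite -!compA -?(dsum_in1 g g') -?(dsum_in2 g g') !compA e.
have [|a def_a] := cokernel_lift (m := m \oc in1 N N') Kg.
  by rewrite -compA -(dsum_in1 f f') compA e comp0m.
have [|b def_b] := cokernel_lift (m := m \oc in2 N N') Kg'.
  by rewrite -compA -(dsum_in2 f f') compA e comp0m.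
exists (a \oc pr1 P P' + b \oc pr2 P P').
apply: bip_epi.
  by rewrite def_a -compA dsum_in1 compA !bipE -!(compA _ _ (in1 _ _)) !bipE.
by rewrite def_b -compA dsum_in2 compA !bipE -!(compA _ _ (in2 _ _)) !bipE.
Qed.

(** The shear [b] of the biproduct and the sign on [N] identify this sequence with the split
    conflation. *)
Lemma confl_graph M N (f : hom M N) :
  E (in1 M N + in2 M N \oc f) (f \oc pr1 M N - pr2 M N).
Proof.
pose b := idm (M (+) N) + in2 M N \oc f \oc pr1 M N.
pose b' := idm (M (+) N) - in2 M N \oc f \oc pr1 M N.
have n2 : in2 M N \oc f \oc pr1 M N \oc (in2 M N \oc f \oc pr1 M N) = 0.
  by rewrite -!compA (compA (pr1 M N)) !bipE.
have Ib : is_iso b.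
  by exists b'; rewrite /b /b' !bipE !n2 !bipE addrK subrK.
have IN : is_iso (- idm N) by exists (- idm N); rewrite !bipE opprK.
apply: (ex_iso hE (is_iso_id M) Ib IN) (confl_split M N).
  by rewrite /b !bipE -!compA !bipE.
rewrite /b !bipE !compA -!(compA _ (pr1 M N) (in2 M N)) !bipE.
by rewrite addrC subrK.
Qed.

(** The pair is the graph of [f] followed by [dsum i (idm P)], a composite of inflations. *)
Lemma inflation_pair M N P (i : hom M N) (f : hom M P) :
  inflation E i -> inflation E (in1 N P \oc i + in2 N P \oc f).
Proof.
move=> Ii; have -> : in1 N P \oc i + in2 N P \oc f =
    dsum i (idm P) \oc (in1 M P + in2 M P \oc f).
  by rewrite compDr compA dsum_in1 dsum_in2 compm1.
apply: (ex_infl_comp hE); last exact: inflation_dsum1.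
by exists P, (f \oc pr1 M P - pr2 M P); apply: confl_graph.
Qed.

(** The pushout of [i] along [f] is the cokernel of the pair. The second conflation shows it as an
    extension of [U] by [N], which later gives its cofibrancy. *)
Lemma confl_pair M Z U N (i : hom M Z) (p : hom Z U) (f : hom M N) :
  E i p -> exists (P : ob A) (g : hom (Z (+) N) P) (i' : hom N P)
    (p' : hom P U), E (in1 Z N \oc i + in2 Z N \oc f) g /\ E i' p'.
Proof.
move=> Eip; have Ii : inflation E i by exists U, p.
have [P [f' [i' [po _]]]] := ex_pushout hE f Ii.
have [p' Ep' _] := pushout_confl hE Eip po; have [e univ] := po.
exists P, (f' \oc pr1 Z N - i' \oc pr2 Z N), i', p'; split=> //.
have pairE Y (u : hom Z Y) (v : hom N Y) :
  (u \oc pr1 Z N - v \oc pr2 Z N) \oc (in1 Z N \oc i + in2 Z N \oc f) =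
  u \oc i - v \oc f.
  by rewrite !bipE !compA -!(compA u) -!(compA v) !bipE.
apply: (inflation_confl hE (inflation_pair _ Ii)).
apply: is_cokernelP => [|Y m n em|Y m em].
- by rewrite pairE e subrr.
- have [|k [_ uniq_k]] := univ Y (n \oc f') (n \oc i').
    by rewrite -!compA e.
  rewrite -(uniq_k n) // -(uniq_k m) //; split.
    by move/(congr1 (fun h => h \oc in1 Z N)): em; rewrite !bipE -!compA !bipE.
  move/(congr1 (fun h => h \oc in2 Z N)): em; rewrite !bipE -!compA !bipE.
  exact: oppr_inj.
have e' : m \oc in1 Z N \oc i = - (m \oc in2 Z N) \oc f.
  apply/eqP; rewrite compNm -subr_eq0 opprK -!compA -compDr; exact/eqP.
have [k [[kf ki] _]] := univ Y _ _ e'.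
exists k; rewrite compBr !compA kf ki compNm opprK -!compA -compDr bip_id.
by rewrite compm1.
Qed.

(** The square formed by [l], [g], [u], [r] is a pushout, because maps out of [N'] are maps out of
    [P] that kill [g \oc f]; so the conflation of [g] can be pushed out along [l]. *)
Lemma confl_noether M N P P' N' M' (f : hom M N) (g : hom N P)
    (l : hom N P') (h : hom P M') (u : hom P N')
    (r : hom P' N') (s : hom N' M') :
  E f l -> E g h -> E (g \oc f) u ->
  r \oc l = u \oc g -> s \oc u = h -> E r s.
Proof.
move=> Ef Eg Egf e1 e2.
have [Kl Ku] := (confl_coker hE Ef, confl_coker hE Egf).
have [|s' Es' def_s'] := @pushout_confl _ _ hE _ _ _ _ _ _ _ l u r Eg.
  split=> // Z a b e; have [|n def_a] := cokernel_lift (m := a) Ku.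
    by rewrite compA e -compA (proj1 Kl) compm0.
  exists n; split=> [|n' [def_n' _]]; last first.
    by apply: (cokernel_epi Ku); rewrite def_n'.
  split=> //; apply: (cokernel_epi Kl).
  by rewrite -e -compA e1 compA -def_a.
have -> : s = s' by apply: (cokernel_epi Ku); rewrite e2 def_s'.
by [].
Qed.

End Exact.

(** * Vanishing of Ext^1 *)

Section Extensions.
Variables (A : addCat) (E : conflations A) (hE : exact_structure E).
Implicit Types M N P K : ob A.

Lemma section_of_retraction M N P (f : hom M N) (g : hom N P) (r : hom N M) :
  E f g -> r \oc f = idm M -> exists s, g \oc s = idm P.
Proof.
move=> Efg rf; have Kg := confl_coker hE Efg.
have [|s def_s] := cokernel_lift (m := idm N - f \oc r) Kg.
  by rewrite compBl -compA rf comp1m compm1 subrr.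
exists s; apply: (cokernel_epi Kg); rewrite -compA -def_s compBr compA.
by rewrite (proj1 Kg) !bipE.
Qed.

(** A retraction [r] together with [g] gives the two components of a comparison with the split
    extension. *)
Lemma Ext1_zeroP P M : Ext1_zero E P M <->
  forall N (f : hom M N) (g : hom N P), E f g -> exists r, r \oc f = idm M.
Proof.
split=> [ext N f g /ext [b [bf gb]] | ext N f g Efg].
  by exists (pr1 M P \oc b); rewrite -compA bf pr1_in1.
have [r rf] := ext N f g Efg; exists (in1 M P \oc r + in2 M P \oc g).
have [gf0 _] := confl_coker hE Efg.
by rewrite compDl compDr -!compA rf gf0 !compA !bipE.
Qed.

End Extensions.

Section ExtensionsDual.
Variables (A : addCat) (E : conflations A) (hE : exact_structure E).
Implicit Types M N P K : ob A.

Lemma retraction_of_section M N P (f : hom M N) (g : hom N P) (s : hom P N) :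
  E f g -> g \oc s = idm P -> exists r, r \oc f = idm M.
Proof. exact: (@section_of_retraction (op A) _ (exact_op hE)). Qed.

Lemma Ext1_zero_sectionP P M : Ext1_zero E P M <->
  forall N (f : hom M N) (g : hom N P), E f g -> exists s, g \oc s = idm P.
Proof.
split=> [/(Ext1_zeroP hE) ext N f g Efg | ext].
  by have [r /(section_of_retraction hE Efg)] := ext N f g Efg.
apply/(Ext1_zeroP hE) => N f g Efg.
by have [s /(retraction_of_section Efg)] := ext N f g Efg.
Qed.

Lemma Ext1_zero_op P M : Ext1_zero E P M <-> Ext1_zero (opE E) M P.
Proof.
split=> [/Ext1_zero_sectionP ext | /(Ext1_zeroP (exact_op hE)) ext].
  by apply/(Ext1_zeroP (exact_op hE)) => N f g; apply: ext.
by apply/Ext1_zero_sectionP => N f g; apply: ext.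
Qed.

(** Pull the conflation back along [c]; a section of the resulting deflation gives the lift. *)
Lemma Ext1_lift P M N Q (f : hom M N) (g : hom N Q) (c : hom P Q) :
  Ext1_zero E P M -> E f g -> exists l : hom P N, c = g \oc l.
Proof.
move=> /Ext1_zero_sectionP ext Efg; have Dg : deflation E g by exists M, f.
have [P' [f' [p' [pb _]]]] := ex_pullback hE c Dg.
have [k' Ek' _] := pullback_confl hE Efg pb.
have [s p's] := ext _ _ _ Ek'.
by exists (f' \oc s); rewrite compA (proj1 pb) -compA p's compm1.
Qed.

End ExtensionsDual.

Section ExtensionClosed.
Variables (A : addCat) (E : conflations A) (hE : exact_structure E).
Implicit Types M N P K : ob A.

Lemma Ext1_extend P M N Q (f : hom Q N) (g : hom N P) (a : hom Q M) :
  Ext1_zero E P M -> E f g -> exists l : hom N M, a = l \oc f.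
Proof.
move=> /(Ext1_zero_op hE) ext Efg.
exact: (@Ext1_lift (op A) _ (exact_op hE) _ _ _ _ g f a ext Efg).
Qed.

(** Stands in for the long exact sequence. An extension of [N] by [K] pulled back along [f] splits;
    its retraction extends from [Y'] to [Y], because [Y' -> Y] is an inflation with cokernel [P]. *)
Lemma Ext1_zero_mid K M N P (f : hom M N) (g : hom N P) : E f g ->
  Ext1_zero E M K -> Ext1_zero E P K -> Ext1_zero E N K.
Proof.
move=> Efg extM extP; apply/(Ext1_zeroP hE) => Y k y Eky.
have Dy : deflation E y by exists K, k.
have [Y' [f' [y' [pb _]]]] := ex_pullback hE f Dy; have [e univ] := pb.
have [k' Ek' f'k'] := pullback_confl hE Eky pb.
have Kf := confl_ker hE Efg.
have mono_f' Z (m n : hom Z Y') : f' \oc m = f' \oc n -> m = n.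
  move=> mn; have [|u [_ uniq_u]] := univ Z (f' \oc n) (y' \oc n).
    by rewrite !compA e.
  rewrite -(uniq_u n) // -(uniq_u m) //; split=> //.
  by apply: (kernel_mono Kf); rewrite !compA -e -!compA mn.
have Ef' : E f' (g \oc y).
  apply: (deflation_confl hE).
    by apply: (ex_defl_comp hE) => //; exists M, f.
  apply: is_kernelP => // [|Z m].
    by rewrite -compA e compA (proj1 Kf) comp0m.
  rewrite -compA => /(kernel_lift Kf) [n /univ [u [[<- _] _]]].
  by exists u.
have [r rk'] := proj1 (Ext1_zeroP hE _ _) extM _ _ _ Ek'.
have [r' def_r] := Ext1_extend r extP Ef'.
by exists r'; rewrite -f'k' compA -def_r.
Qed.

Lemma Ext1_zero_iso K M N (f : hom M N) :
  is_iso f -> Ext1_zero E M K -> Ext1_zero E N K.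
Proof.
move=> [g [gf fg]] ext; apply/(Ext1_zero_sectionP hE) => Y k y Eky.
have [l def_f] := Ext1_lift hE f ext Eky.
by exists (l \oc g); rewrite compA -def_f.
Qed.

Lemma Ext1_zero_zob K : Ext1_zero E (zob A) K.
Proof.
apply/(Ext1_zero_sectionP hE) => Y k y _.
by exists 0; rewrite compm0 idm_zob.
Qed.

(** * Dualization of Hovey triples, and additive subcategories *)

Lemma cotorsion_pair_op (C F : set (ob A)) :
  cotorsion_pair E C F -> @cotorsion_pair (op A) (opE E) F C.
Proof.
move=> [defC defF]; split.
  rewrite {1}defF; apply/seteqP; split=> M ext N /ext.
    by move/(Ext1_zero_op hE).
  by move=> e; apply/(Ext1_zero_op hE).
rewrite {1}defC; apply/seteqP; split=> M ext N /ext.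
  by move/(Ext1_zero_op hE).
by move=> e; apply/(Ext1_zero_op hE).
Qed.

Lemma complete_cotorsion_pair_op (C F : set (ob A)) :
  complete_cotorsion_pair E C F ->
  @complete_cotorsion_pair (op A) (opE E) F C.
Proof.
move=> [cot pre post]; split; first exact: cotorsion_pair_op.
  by move=> M; have [R [Q [i [p [? ? ?]]]]] := post M; exists Q, R, p, i.
by move=> M; have [K [Q [i [p [? ? ?]]]]] := pre M; exists Q, K, p, i.
Qed.

Lemma thick_op (W : set (ob A)) : thick E W -> @thick (op A) (opE E) W.
Proof.
move=> tW; split.
- move=> M S [M' [i [i' [p [p' [e1 e2 e3 e4 e5]]]]]].
  by apply: (thick_summand tW); exists M', p, p', i, i'.
- by move=> M N P f g Efg WN WP; apply: (thick_right tW) Efg WP WN.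
- by move=> M N P f g Efg WM WP; apply: (thick_mid tW) Efg WP WM.
- by move=> M N P f g Efg WM WN; apply: (thick_left tW) Efg WN WM.
Qed.

Lemma hovey_op (C W F : set (ob A)) :
  hovey_triple E C W F -> @hovey_triple (op A) (opE E) F W C.
Proof.
move=> [tW cotC cotF]; split; first exact: thick_op.
  by rewrite setIC; apply: complete_cotorsion_pair_op.
by rewrite setIC; apply: complete_cotorsion_pair_op.
Qed.

Lemma additive_subcat_op (X : set (ob A)) :
  @additive_subcat (op A) X -> @additive_subcat A X.
Proof.
move=> [X0 XD Xiso]; split=> // M N f [g [gf fg]].
by apply: (Xiso M N g); exists f.
Qed.

Lemma additive_subcatI (X Y : set (ob A)) :
  additive_subcat X -> additive_subcat Y -> additive_subcat (X `&` Y).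
Proof.
move=> [X0 XD Xiso] [Y0 YD Yiso]; split=> //.
  by move=> M N [XM YM] [XN YN]; split; [apply: XD | apply: YD].
by move=> M N f If [XM YM]; split; [apply: (Xiso _ _ f) | apply: (Yiso _ _ f)].
Qed.

(** The empty class is thick, so a member [M] is required: the zero object is a summand of it. An
    object isomorphic to a member is a summand with zero complement. *)
Lemma thick_additive (W : set (ob A)) M : thick E W -> W M -> additive_subcat W.
Proof.
move=> tW WM; split.
- apply: (thick_summand tW) WM.
  exists M, 0, (idm M), 0, (idm M).
  by rewrite !bipE idm_zob.
- by move=> N N' WN WN'; apply: (thick_mid tW (confl_split hE N N')).
move=> N N' f [g [gf fg]]; apply: (thick_summand tW).
by exists (zob A), g, 0, f, 0; rewrite !bipE idm_zob.
Qed.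

End ExtensionClosed.

Lemma section_summand (A : addCat) (E : conflations A)
    (hE : exact_structure E) (K N P : ob A) (f : hom K N) (g : hom N P)
    (s : hom P N) : E K N P f g -> g \oc s = idm P -> direct_summand P N.
Proof.
move=> Efg gs; have Kf := confl_ker hE Efg; have gf0 := proj1 Kf.
have [|r def_r] := kernel_lift (m := idm N - s \oc g) Kf.
  by rewrite compBr compA gs comp1m compm1 subrr.
exists K, s, f, g, r; split=> //; last by rewrite -def_r addrC subrK.
  apply: (kernel_mono Kf).
  by rewrite compA -def_r compBl -compA gf0 !bipE.
apply: (kernel_mono Kf).
by rewrite compA -def_r compBl -compA gs !bipE subrr.
Qed.

(** * Hovey triples *)

Section Hovey.
Variables (A : addCat) (E : conflations A) (hE : exact_structure E).
Variables (C W F : set (ob A)) (hH : hovey_triple E C W F).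
Implicit Types M N P K : ob A.
Let X := C `&` W `&` F.

Let tW : thick E W. Proof. by case: hH. Qed.

Lemma Ext1_C_WF M K : C M -> W K -> F K -> Ext1_zero E M K.
Proof.
by case: hH => _ [[defC _] _ _] _; rewrite defC => CM WK FK; apply: CM.
Qed.

Lemma Ext1_CW_F M K : C M -> W M -> F K -> Ext1_zero E M K.
Proof.
by case: hH => _ _ [[_ defF] _ _]; rewrite defF => CM WM; apply.
Qed.

Lemma C_of_Ext1 M : (forall K, W K -> F K -> Ext1_zero E M K) -> C M.
Proof.
by case: hH => _ [[defC _] _ _] _ ext; rewrite defC => K [WK FK]; apply: ext.
Qed.

Lemma cofibrant_mid M N P (f : hom M N) (g : hom N P) :
  E f g -> C M -> C P -> C N.
Proof.
move=> Efg CM CP; apply: C_of_Ext1 => K WK FK.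
by apply: (Ext1_zero_mid hE Efg); apply: Ext1_C_WF.
Qed.

Lemma additive_cofibrant : additive_subcat C.
Proof.
split; first by apply: C_of_Ext1 => K _ _; apply: (Ext1_zero_zob hE).
  by move=> M N CM CN; apply: (cofibrant_mid (confl_split hE M N)).
move=> M N f If CM; apply: C_of_Ext1 => K WK FK.
by apply: (Ext1_zero_iso hE If); apply: Ext1_C_WF.
Qed.

Lemma additive_weak : additive_subcat W.
Proof.
case: hH => _ [_ pre _] _; have [K [Q [i [p [_ [WK _] _]]]]] := pre (zob A).
exact: (thick_additive hE tW WK).
Qed.

(** The special preenvelope of the pair with left class [C] has its target in [X], since that target
    is an extension of the cofibrant [U] by [M]. *)
Lemma cofibrant_to_X M : C M -> exists (Z U : ob A) (i : hom M Z) (p : hom Z U),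
  [/\ E i p, X Z, C U & W M -> W U].
Proof.
move=> CM; case: hH => _ [_ _ post] _.
have [Z [U [i [p [Eip [WZ FZ] CU]]]]] := post M.
exists Z, U, i, p; split=> // [|WM]; last exact: (thick_right tW Eip).
by split=> //; split=> //; apply: (cofibrant_mid Eip).
Qed.

(** Embed [M] into an object of [X]; by thickness the cokernel lies in both [C] and [W], so [f]
    extends to that object. *)
Lemma CW_F_factors M N (f : hom M N) : C M -> W M -> F N -> factors_via X f.
Proof.
move=> CM WM FN; have [Z [U [i [p [Eip XZ CU WU]]]]] := cofibrant_to_X CM.
have [l ->] := Ext1_extend hE f (Ext1_CW_F CU (WU WM) FN) Eip.
by exists Z, i, l.
Qed.

Lemma cofibrant_confl_monic M N P (f : hom M N) (g : hom N P) :
  E f g -> C P -> is_monic_for X f.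
Proof.
move=> Efg CP Z [[_ WZ] FZ] h.
exact: (Ext1_extend hE h (Ext1_C_WF CP WZ FZ) Efg).
Qed.

(** The sequences are the special preenvelopes of the pair with right class [F]; for cofibrant [M]
    the middle term is an extension of cofibrant objects. *)
Lemma localization_left : exists (R Wo : ob A -> ob A)
    (j : forall M, hom M (R M)) (t : forall M, hom (R M) (Wo M)),
  (forall M, [/\ preenvelope F (j M), weak_cokernel (j M) (t M)
               & stab_lperp X F (Wo M)])
  /\ (forall M, C M -> (C `&` F) (R M)).
Proof.
(* Both objects and both maps are packed into one sigma type, so that a single choice selects them
   together. *)
have H M : exists s : {R : ob A & {Q : ob A & (hom M R * hom R Q)%type}},
    [/\ E (projT2 (projT2 s)).1 (projT2 (projT2 s)).2, F (projT1 s)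
      & (C `&` W) (projT1 (projT2 s))].
  case: hH => _ _ [_ _ post]; have [R [Q [i [p ?]]]] := post M.
  by exists (existT _ R (existT _ Q (i, p))).
pose s M := sval (cid (H M)); have Hs M := svalP (cid (H M)).
exists (fun M => projT1 (s M)), (fun M => projT1 (projT2 (s M))).
exists (fun M => (projT2 (projT2 (s M))).1).
exists (fun M => (projT2 (projT2 (s M))).2).
split=> M; have [Ejt FR [CQ WQ]] := Hs M.
  split.
  - split=> // Z FZ h; exact: (Ext1_extend hE h (Ext1_CW_F CQ WQ FZ) Ejt).
  - exact: cokernel_weak (confl_coker hE Ejt).
  by move=> N FN f; rewrite /stab_eq subr0; apply: CW_F_factors.
by move=> CM; split=> //; apply: (cofibrant_mid Ejt).
Qed.

End Hovey.

(** * Dual statements and the localization triple *)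

Section HoveyDual.
Variables (A : addCat) (E : conflations A) (hE : exact_structure E).
Variables (C W F : set (ob A)) (hH : hovey_triple E C W F).
Implicit Types M N P K : ob A.
Let X := C `&` W `&` F.

Let hEop := exact_op hE.
Let hHop := hovey_op hE hH.

(** The reversed triple yields its core with the intersections in another order; this equality
    transports dual results. *)
Lemma dual_core : F `&` W `&` C = X.
Proof. by rewrite /X setIC setIA setIAC -setIA setICA setIA. Qed.

Lemma additive_fibrant : additive_subcat F.
Proof. exact/additive_subcat_op/(additive_cofibrant hEop hHop). Qed.

Lemma fibrant_from_X M : F M -> exists (K Z : ob A) (i : hom K Z) (p : hom Z M),
  [/\ E i p, X Z & F K].
Proof.
move=> FM; have [Z [K [p [i]]]] := cofibrant_to_X hEop hHop FM.
by rewrite dual_core => -[? ? ? _]; exists K, Z, i, p.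
Qed.

Lemma additive_core : additive_subcat X.
Proof.
apply: additive_subcatI; last exact: additive_fibrant.
by apply: additive_subcatI; [apply: (additive_cofibrant hE hH) |
  apply: (additive_weak hE hH)].
Qed.

Lemma localization_hovey : localization_triple C X F.
Proof.
split; [exact: (additive_cofibrant hE hH) | exact: additive_core |
  exact: additive_fibrant | by move=> M [[]] | |
  exact: (localization_left hE hH)].
have [Q [Wo [r [w [H1 H2]]]]] := localization_left hEop hHop.
exists Wo, Q, w, r; split=> M.
  have [pre wc st] := H1 M; rewrite dual_core in st; split=> // N CN f.
  by have [Z [a [b [XZ def_f]]]] := st N CN f; exists Z, b, a.
by move=> FM; rewrite setIC; apply: H2.
Qed.

End HoveyDual.

(** * Stable categories and weak equivalences *)

Section Stable.
Variables (A : addCat) (X : set (ob A)) (aX : additive_subcat X).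
Implicit Types M N P : ob A.

Lemma factors_compl M N P (g : hom N P) (f : hom M N) :
  factors_via X f -> factors_via X (g \oc f).
Proof.
by move=> [Z [a [b [XZ ->]]]]; exists Z, a, (g \oc b); rewrite compA.
Qed.

Lemma factors_compr M N P (g : hom N P) (f : hom M N) :
  factors_via X g -> factors_via X (g \oc f).
Proof.
by move=> [Z [a [b [XZ ->]]]]; exists Z, (a \oc f), b; rewrite compA.
Qed.

Lemma factorsN M N (f : hom M N) : factors_via X f -> factors_via X (- f).
Proof. by move=> [Z [a [b [XZ ->]]]]; exists Z, a, (- b); rewrite compNm. Qed.

Lemma factorsD M N (f g : hom M N) :
  factors_via X f -> factors_via X g -> factors_via X (f + g).
Proof.
move=> [Z [a [b [XZ ->]]]] [Z' [a' [b' [XZ' ->]]]]; case: aX => _ XD _.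
exists (Z (+) Z'), (in1 Z Z' \oc a + in2 Z Z' \oc a').
exists (b \oc pr1 Z Z' + b' \oc pr2 Z Z'); split; first exact: XD.
by rewrite !bipE !compA -!(compA _ (pr1 _ _)) -!(compA _ (pr2 _ _)) !bipE.
Qed.

Lemma factors0 M N : factors_via X (0 : hom M N).
Proof.
by case: aX => X0 _ _; exists (zob A), 0, 0; split=> //; rewrite comp0m.
Qed.

Lemma stab_refl M N (f : hom M N) : stab_eq X f f.
Proof. by rewrite /stab_eq subrr; apply: factors0. Qed.

Lemma stab_sym M N (f g : hom M N) : stab_eq X f g -> stab_eq X g f.
Proof. by move/factorsN; rewrite opprB. Qed.

Lemma stab_trans M N (g f h : hom M N) :
  stab_eq X f g -> stab_eq X g h -> stab_eq X f h.
Proof. by move=> fg gh; have := factorsD fg gh; rewrite addrA subrK. Qed.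

Lemma stab_compl M N P (g : hom N P) (f f' : hom M N) :
  stab_eq X f f' -> stab_eq X (g \oc f) (g \oc f').
Proof. by rewrite /stab_eq -compBr; apply: factors_compl. Qed.

Lemma stab_compr M N P (g g' : hom N P) (f : hom M N) :
  stab_eq X g g' -> stab_eq X (g \oc f) (g' \oc f).
Proof. by rewrite /stab_eq -compBl; apply: factors_compr. Qed.

Lemma stab_factors M N (f g : hom M N) :
  stab_eq X f g -> factors_via X g -> factors_via X f.
Proof. by move=> fg /(factorsD fg); rewrite subrK. Qed.

Variable F : set (ob A).

(* [f] induces bijections Hom(N, Z) -> Hom(M, Z) in A/X for all [Z] in [F]; for
   [M], [N] cofibrant and [F] the fibrant objects these are the weak
   equivalences. *)
Definition stab_weq M N (f : hom M N) := forall Z, F Z ->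
  (forall y : hom M Z, exists y' : hom N Z, stab_eq X (y' \oc f) y) /\
  (forall y : hom N Z, factors_via X (y \oc f) -> factors_via X y).

Lemma weq_comp M N P (g : hom N P) (f : hom M N) :
  stab_weq f -> stab_weq g -> stab_weq (g \oc f).
Proof.
move=> wf wg Z FZ; have [surj_f inj_f] := wf Z FZ.
have [surj_g inj_g] := wg Z FZ.
split=> [y|y]; last by rewrite compA => /inj_f /inj_g.
have [y1 e1] := surj_f y; have [y2 e2] := surj_g y1; exists y2.
by rewrite compA; apply: stab_trans e1; apply: stab_compr.
Qed.

(** One case of two-out-of-three; it will pass from [sj] to [shat] in a naturality square. *)
Lemma weq_cancel M N P (g : hom N P) (f : hom M N) :
  stab_weq f -> stab_weq (g \oc f) -> stab_weq g.
Proof.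
move=> wf wg Z FZ; have [surj_f inj_f] := wf Z FZ.
have [surj_g inj_g] := wg Z FZ; split=> [y|y Xy].
  have [y' e] := surj_g (y \oc f); exists y'; apply: inj_f.
  by rewrite compBl -compA.
by apply: inj_g; rewrite compA; apply: factors_compr.
Qed.

Lemma weq_stab_eq M N (f g : hom M N) :
  stab_eq X f g -> stab_weq f -> stab_weq g.
Proof.
move=> fg wf Z FZ; have [surj_f inj_f] := wf Z FZ; split=> [y|y Xy].
  have [y' e] := surj_f y; exists y'; apply: stab_trans e.
  exact/stab_compl/stab_sym.
by apply: inj_f; apply: stab_factors Xy; apply: stab_compl.
Qed.

Lemma weq_stab_iso M N (f : hom M N) : stab_iso X f -> stab_weq f.
Proof.
move=> [g [gf fg]] Z FZ; split=> [y|y Xy].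
  exists (y \oc g); rewrite -compA -[X in stab_eq _ _ X]compm1.
  exact: stab_compl.
apply: (@stab_factors _ _ _ (y \oc f \oc g)); last exact: factors_compr.
by rewrite -compA -[X in stab_eq _ X]compm1; apply/stab_compl/stab_sym.
Qed.

(** Yoneda: surjectivity at [M] gives a left inverse [g], and injectivity at [N], applied to
    [f \oc g - idm N], makes it two-sided. *)
Lemma stab_iso_weq M N (f : hom M N) :
  F M -> F N -> stab_weq f -> stab_iso X f.
Proof.
move=> FM FN wf; have [g gf] := (wf M FM).1 (idm M).
exists g; split=> //; apply: (wf N FN).2.
rewrite compBl -compA comp1m -[X in _ - X]compm1 -compBr.
exact: factors_compl.
Qed.

End Stable.

(** * The partial right triangulated structure *)

Section RightStructure.
Variables (A : addCat) (E : conflations A) (hE : exact_structure E).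
Variables (C W F : set (ob A)) (hH : hovey_triple E C W F).
Variables (S : addFunctor A A) (hS : forall M, idm (S M) = 0).
Implicit Types M N P K : ob A.
Let X := C `&` W `&` F.
Let aX : additive_subcat X := additive_core hE hH.
Let aC : additive_subcat C := additive_cofibrant hE hH.

(* [S] is any functor with zero values rather than [zeroF A], because
   [opF (zeroF A)] and [zeroF (op A)] are not convertible. *)
Definition confl_triangles : rclass S := fun M N P f g _ => E f g /\ C P.

Lemma factors_extend M N P K (f : hom M N) (g : hom N P) (a : hom M K) :
  E f g -> C P -> factors_via X a ->
  exists2 e : hom N K, a = e \oc f & factors_via X e.
Proof.
move=> Efg CP [Z [u [v [XZ ->]]]].
have [u' ->] := cofibrant_confl_monic hE hH Efg CP XZ u.
by exists (v \oc u'); [rewrite compA | exists Z, u', v].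
Qed.

(** Objects of [X] lie in [C] and in [W], so their Ext^1 into the fibrant kernel vanishes. *)
Lemma factors_lift K N P M (i : hom K N) (p : hom N P) (a : hom M P) :
  E i p -> F K -> factors_via X a -> exists e : hom M N, a = p \oc e.
Proof.
move=> Eip FK [Z [u [v [[[CZ WZ] _] ->]]]].
have [v' ->] := Ext1_lift hE v (Ext1_CW_F hH CZ WZ FK) Eip.
by exists (v' \oc u); rewrite compA.
Qed.

(** Surjectivity is the vanishing of Ext^1 from [P]. For injectivity, subtract from [y] an extension
    of the factorization of [y \oc f]; the difference descends to [P], and maps from [P] to [Z]
    factor through [X]. *)
Lemma weq_inflation M N P (f : hom M N) (g : hom N P) :
  E f g -> C P -> W P -> stab_weq X F f.
Proof.
move=> Efg CP WP Z FZ; have extP := Ext1_CW_F hH CP WP; split=> [y|y].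
  have [y' ->] := Ext1_extend hE y (extP _ FZ) Efg.
  by exists y'; apply: stab_refl.
move=> [Y [u [v [XY e]]]].
have [u' def_u] := Ext1_extend hE u (extP _ XY.2) Efg.
have [|n def_n] := cokernel_lift (m := y - v \oc u') (confl_coker hE Efg).
  by rewrite compBl e def_u compA subrr.
rewrite -[y](subrK (v \oc u')) def_n; apply: factorsD => //; last first.
  by exists Y, u', v.
exact/factors_compr/(CW_F_factors hE hH).
Qed.

(* The five lemma for [Hom(N, L) -> Hom(M, L) -> Hom(P, Z) -> Hom(N, Z) ->
   Hom(M, Z)] in A/X, where [L] is the kernel of a deflation from an object of
   [X] onto [Z]; no suspension occurs in it. *)
Lemma weq_coker M N P M' N' P' (f : hom M N) (g : hom N P)
    (f' : hom M' N') (g' : hom N' P')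
    (a : hom M M') (b : hom N N') (c : hom P P') :
  E f g -> C P -> E f' g' -> C P' -> b \oc f = f' \oc a -> c \oc g = g' \oc b ->
  stab_weq X F a -> stab_weq X F b -> stab_weq X F c.
Proof.
move=> Ef CP Ef' CP' sq1 sq2 wa wb Z FZ.
have [L [Y [i [p [Eip XY FL]]]]] := fibrant_from_X hE hH FZ.
have [Kg Kg'] := (confl_coker hE Ef, confl_coker hE Ef').
have [gf0 g'f'0] := (proj1 Kg, proj1 Kg').
have Ki := confl_ker hE Eip; have pi0 := proj1 Ki.
split=> [y|z Xzc].
  (* Surjectivity: a preimage [y1] of [y \oc g] is corrected by [v], trivial in the stable category,
     so that it descends to [z] on [P']. *)
  have [y1 e1] := (wb Z FZ).1 (y \oc g).
  have /(factors_extend Ef' CP') [v def_v Xv] : factors_via X (y1 \oc f').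
    apply: (wa Z FZ).2; rewrite -compA -sq1 compA.
    rewrite -[_ \oc f]subr0 -[0](compm0 _ y) -gf0 compA.
    exact: stab_compr.
  have [|z def_z] := cokernel_lift (m := y1 - v) Kg'.
    by rewrite compBl def_v subrr.
  (* The error [z \oc c - y] dies stably after [g], hence is recorded by some [n : M -> L].
     Transporting [n] along [a] to [n1] and then to [P'] gives the correction [z1]. *)
  have [|d def_d] := factors_lift (a := (z \oc c - y) \oc g) Eip FL.
    rewrite compBl -compA sq2 compA -def_z compBl.
    by rewrite addrAC; apply: factorsD => //; apply/factorsN/factors_compr.
  have [|n def_n] := kernel_lift (m := d \oc f) Ki.
    by rewrite compA -def_d -compA gf0 compm0.
  have [n1 e2] := (wa L FL).1 n.
  have [d1 def_d1] := cofibrant_confl_monic hE hH Ef' CP' XY (i \oc n1).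
  have [|z1 def_z1] := cokernel_lift (m := p \oc d1) Kg'.
    by rewrite -compA -def_d1 compA pi0 comp0m.
  have [e def_e _] := factors_extend Ef CP e2.
  have [|k def_k] := cokernel_lift (m := d1 \oc b - d - i \oc e) Kg.
    rewrite !compBl -!compA sq1 def_n -def_e compA -def_d1 -compA.
    by rewrite -compBr -compBr subrr compm0.
  exists (z - z1).
  have def_pk : z1 \oc c - (z \oc c - y) = p \oc k.
    apply: (cokernel_epi Kg).
    rewrite compBl def_d -!compA sq2 -def_k compA -def_z1 !compBr !compA pi0.
    by rewrite comp0m subr0.
  rewrite /stab_eq compBl.
  have -> : z \oc c - z1 \oc c - y = - (p \oc k).
    by rewrite -def_pk opprB addrAC.
  by apply: factorsN; exists Y, k, p.
(* Injectivity: the lift [d] of [z \oc g'] to [Y] is modified by a map into [L] until it kills [f'];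
   it then descends to a lift of [z] itself. *)
have [|d def_d] := factors_lift (a := z \oc g') Eip FL.
  apply: (wb Z FZ).2; rewrite -compA -sq2 compA; exact: factors_compr.
have [|n def_n] := kernel_lift (m := d \oc f') Ki.
  by rewrite compA -def_d -compA g'f'0 compm0.
have [e def_e] := factors_lift Eip FL Xzc.
have [|n0 def_n0] := kernel_lift (m := d \oc b - e \oc g) Ki.
  by rewrite compBr !compA -def_d -def_e -!compA sq2 subrr.
have [n1 e1] := (wb L FL).1 n0.
have [|v def_v Xv] := factors_extend (a := n - n1 \oc f') Ef' CP'.
  apply: (wa L FL).2; rewrite compBl -compA -sq1 compA.
  have -> : n \oc a = n0 \oc f.
    apply: (kernel_mono Ki); rewrite !compA -def_n -def_n0 compBl -!compA gf0.
    by rewrite compm0 subr0 sq1.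
  by rewrite -compBl; apply/factors_compr/stab_sym.
have [|k def_k] := cokernel_lift (m := d - i \oc (n1 + v)) Kg'.
  by rewrite compBl -compA compDl -def_v [_ + (n - _)]addrC subrK def_n subrr.
have -> : z = p \oc k; last by exists Y, k, p.
apply: (cokernel_epi Kg').
by rewrite -compA -def_k compBr compA pi0 comp0m subr0.
Qed.

(** Embed [P] into a fibrant [R] with cokernel [Q] in [C] and [W]. As [R] is also cofibrant, [i]
    factors through [X], which makes [idm R] factor through [X] as well. So [R] is a summand of an
    object of [X], and thickness gives [W P]. *)
Lemma special_cokernel_weak M N P (j : hom M N) (k : hom N P)
    (l : hom P (S M)) :
  special_tri confl_triangles X (C `&` F) j k l -> W P.
Proof.
move=> [[_ CP] _ null]; case: (hH) => tW _ [_ _ post].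
have [R [Q [i [p [Eip FR [CQ WQ]]]]]] := post P.
have CR := cofibrant_mid hE hH Eip CP CQ.
apply: (thick_left tW Eip) => //.
have [Z [u [v [XZ def_i]]]] : factors_via X i.
  by rewrite -[i]subr0; apply: null.
have [u' def_u] := Ext1_extend hE u (Ext1_CW_F hH CQ WQ XZ.2) Eip.
have [|w def_w] := cokernel_lift (m := idm R - v \oc u') (confl_coker hE Eip).
  by rewrite compBl -compA -def_u comp1m def_i subrr.
have [K [Y [i' [p' [Ei' [[_ WY] _] FK]]]]] := fibrant_from_X hE hH FR.
have [|s p's] := factors_lift (a := idm R) Ei' FK.
  rewrite -(subrK (v \oc u') (idm R)) def_w; apply: factorsD => //.
    exact/factors_compr/(CW_F_factors hE hH).
  by exists Z, u', v.
exact: (thick_summand tW (section_summand hE Ei' (esym p's))).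
Qed.

Lemma partial_right_confl : partial_right_triangulated confl_triangles C X.
Proof.
have S0 M N (f g : hom M (S N)) : f = g.
  by rewrite (hom_to_null f) ?(hom_to_null g).
split=> //.
- by move=> M [[]].
- move=> M N P f g h [Efg CP]; have Kg := confl_coker hE Efg; split=> //.
    exact: cokernel_weak.
  (* As [g] is epic and [S M] is null, killing [g] and factoring through [h] both mean being
     zero. *)
  move=> Z m; split=> [mg0|[n ->]]; last first.
    by rewrite (S0 _ _ h 0) !(compm0, comp0m).
  by exists 0; rewrite comp0m; apply: (cokernel_epi Kg); rewrite mg0 comp0m.
- move=> M N P f g h M' N' P' f' g' h' a b c Ia Ib Ic [e1 e2 _] [Efg CP].
  split; first exact: (ex_iso hE Ia Ib Ic e1 e2 Efg).
  by case: aC => _ _ isoC; apply: isoC Ic CP.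
- split; last by case: aC.
  have := confl_0id hE (zob A); by rewrite idm_zob.
- move=> M N P f g h M' N' P' f' g' h' [Ef CP] [Ef' CP'].
  by split; [apply: confl_dsum | case: aC => _ DC _; apply: DC].
- move=> M CM; have [Z [U [i [p [Eip XZ CU _]]]]] := cofibrant_to_X hE hH CM.
  exists Z, U, i, p, 0; split=> //; split=> //.
  exact: (cofibrant_confl_monic hE hH Eip CU).
- by move=> M N f CM CN; split=> //; apply: confl_graph.
- move=> M Z U i p q [Eip CU] CM _ N f CN.
  have [P [g [i' [p' [Eg Ei']]]]] := confl_pair hE f Eip.
  by exists P, g, 0; split=> //; apply: (cofibrant_mid hE hH Ei').
- move=> M N P f g h M' Z U f' s h' a b c [Ef CP] [Es CU] XZ [sq1 sq2 _].
  move=> [e def_a].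
  have Kg := confl_coker hE Ef.
  (* Since [b - f' \oc e] kills [f], it factors through [g], and the factor lifts [c] along [s]. *)
  have [|k def_k] := cokernel_lift (m := b - f' \oc e) Kg.
    by rewrite compBl sq1 def_a compA subrr.
  exists k; apply: (cokernel_epi Kg).
  rewrite -compA -def_k compBr compA (proj1 (confl_coker hE Es)) comp0m.
  by rewrite subr0.
- move=> M N P f g h M' N' P' f' g' h' a b [Ef CP] [Ef' CP'] sq.
  have [|c def_c] := cokernel_lift (m := g' \oc b) (confl_coker hE Ef).
    by rewrite -compA sq compA (proj1 (confl_coker hE Ef')) comp0m.
  by exists c; split.
move=> M N P f g P' l m M' h j N' u v [Ef CP'] [Eg CM'] [Egf CN'] CM CN CP _ _.
have [|r def_r] := cokernel_lift (m := u \oc g) (confl_coker hE Ef).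
  by rewrite -compA (proj1 (confl_coker hE Egf)).
have [|s def_s] := cokernel_lift (m := h) (confl_coker hE Egf).
  by rewrite compA (proj1 (confl_coker hE Eg)) comp0m.
have Ers : E r s by apply: (confl_noether hE Ef Eg Egf).
by exists r, s; split=> //; apply: (cofibrant_confl_monic hE hH Ers).
Qed.

Lemma special_preenveloping_confl :
  special_preenveloping confl_triangles C X (C `&` F).
Proof.
move=> M CM; case: (hH) => _ _ [_ _ post].
have [R [Q [i [p [Eip FR [CQ WQ]]]]]] := post M.
exists R, Q, i, p, 0; split=> // [|Z [_ FZ] f].
  split; first by split=> //; apply: (cofibrant_mid hE hH Eip).
  move=> Z [_ FZ] h.
  exact: (Ext1_extend hE h (Ext1_CW_F hH CQ WQ FZ) Eip).
by rewrite /stab_eq subr0; apply: (CW_F_factors hE hH).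
Qed.

Lemma stab_iso_inv M N (f : hom M N) : stab_iso X f ->
  exists2 g : hom N M, stab_iso X g &
    stab_eq X (g \oc f) (idm M) /\ stab_eq X (f \oc g) (idm N).
Proof. by case=> g [gf fg]; exists g; [exists f|]. Qed.

(** * The cofibrant-fibrant objects are stabilizing *)

Section Stabilizing.

#[local] Instance stab_equivalence M N : Equivalence (@stab_eq A X M N).
Proof.
by split=> [f|f g|f g h];
  [apply: stab_refl | apply: stab_sym | apply: stab_trans].
Qed.

#[local] Instance stab_comp_proper M N P :
  Proper (@stab_eq A X N P ==> @stab_eq A X M N ==> @stab_eq A X M P)
    (@comp A M N P).
Proof.
move=> g g' eg f f' ef; apply: (stab_trans aX); first exact: (stab_compr f eg).
exact: stab_compl.
Qed.

Variable T : rchoice confl_triangles C X.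

(** The given square commutes only stably; changing [b] by a map through [X] makes it commute in
    [A], so that [c] is induced on cokernels and the five lemma applies. *)
Lemma std_Delta_map M N P (f : hom M N) (g : hom N P) (x : hom P (cU T M))
    M' N' P' (f' : hom M' N') (g' : hom N' P') (x' : hom P' (cU T M'))
    (a : hom M M') (b : hom N N') :
  std_Delta f g x -> std_Delta f' g' x' -> stab_eq X (b \oc f) (f' \oc a) ->
  stab_weq X F a -> stab_weq X F b ->
  exists2 c : hom P P', stab_ladder f g x f' g' x' a b c & stab_weq X F c.
Proof.
move=> [CM CN Xf [h [d [[Ef CP] df xg qx]]]].
move=> [CM' CN' Xf' [h' [d' [[Ef' CP'] df' xg' qx']]]] sq wa wb.
have [v def_v Xv] := factors_extend Ef CP sq.
have bv : stab_eq X b (b - v) by rewrite /stab_eq opprB addrC subrK.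
have sq1 : (b - v) \oc f = f' \oc a by rewrite compBl -def_v opprB addrC subrK.
have [Kg Kg'] := (confl_coker hE Ef, confl_coker hE Ef').
have [|c def_c] := cokernel_lift (m := g' \oc (b - v)) Kg.
  by rewrite -compA sq1 compA (proj1 Kg') comp0m.
exists c; last first.
  by apply: weq_coker Ef CP Ef' CP' sq1 (esym def_c) wa (weq_stab_eq aX bv wb).
split=> //.
  by rewrite -def_c; apply/stab_compl/stab_sym.
have [s [si kp qk]] := c_kappa T a CM CM'.
(* The two composites of the third square differ by [cp T M' \oc k], a map through the object
   [cX T M'] of [X]. *)
have [|k def_k] := cokernel_lift (m := s \oc d - d' \oc (b - v)) Kg.
  by rewrite compBl -!compA df sq1 (compA d') df' si subrr.
exists (cX T M'), k, (cp T M'); split; first by case: (c_tri T CM') => _ [].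
apply: (cokernel_epi Kg); rewrite compBl -!compA xg -def_c -def_k compA kp.
by rewrite (compA x') xg' [RHS]compBr !compA.
Qed.

Lemma special_weq (Y : special_choice confl_triangles C X (C `&` F)) M :
  C M -> stab_weq X F (sj Y M).
Proof.
move=> CM; have tri := s_tri Y CM; have WP := special_cokernel_weak tri.
by case: tri => [[Ejk CP] _ _]; apply: weq_inflation Ejk CP WP.
Qed.

Lemma stabilizing_confl : stabilizing T (C `&` F).
Proof.
have HR := partial_right_confl.
have reflX U V (h : hom U V) : stab_eq X h h by exact: stab_refl.
split.
- by apply: additive_subcatI => //; apply: (additive_fibrant hE hH).
- by move=> M [[]].
- by move=> M [].
- exact: special_preenveloping_confl.
move=> Y M N f CM CN P g x D g' x'.
move=> [_ _ CP [M0 [N0 [P0 [f0 [g0 [x0 [a [b [c]]]]]]]]]].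
move=> [std0 [sq1 sq2 sq3] Ia Ib Ic].
move=> [CRM CRN CD [M1 [N1 [P1 [f1 [g1 [x1 [a1 [b1 [c1]]]]]]]]]].
move=> [std1 [sq1' sq2' sq3'] Ia1 Ib1 Ic1].
have [a' Ia' [a'a aa']] := stab_iso_inv Ia.
have [b' Ib' [b'b bb']] := stab_iso_inv Ib.
have [c1' Ic1' [c1'c1 c1c1']] := stab_iso_inv Ic1.
have [[CM0 CN0 _ _] [CM1 CN1 _ _]] := (std0, std1).
have wj := special_weq Y.
have weqI U V (h : hom U V) : stab_iso X h -> stab_weq X F h.
  exact: weq_stab_iso.
(* The maps [sj] are transported along the stable isomorphisms to the standard sequences; [c2] is
   then transported back to [t]. *)
pose a2 := a1 \oc sj Y M \oc a'; pose b2 := b1 \oc sj Y N \oc b'.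
have wa2 : stab_weq X F a2.
  apply: (weq_comp aX (weqI _ _ _ Ia')).
  exact: (weq_comp aX (wj M CM) (weqI _ _ _ Ia1)).
have wb2 : stab_weq X F b2.
  apply: (weq_comp aX (weqI _ _ _ Ib')).
  exact: (weq_comp aX (wj N CN) (weqI _ _ _ Ib1)).
have a2a : stab_eq X (a2 \oc a) (a1 \oc sj Y M).
  by rewrite -compA a'a compm1.
have b2b : stab_eq X (b2 \oc b) (b1 \oc sj Y N).
  by rewrite -compA b'b compm1.
have sq : stab_eq X (b2 \oc f0) (f1 \oc a2).
  rewrite -[b2 \oc f0]compm1 -aa' compA -(compA b2) -sq1 compA b2b.
  by rewrite -(compA b1) -(s_hat Y f CM CN) compA sq1' !compA.
have [c2 [_ c2g c2x] wc2] := std_Delta_map std0 std1 sq wa2 wb2.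
pose t := c1' \oc c2 \oc c; exists t.
have wt : stab_weq X F t.
  apply: (weq_comp aX (weqI _ _ _ Ic)).
  exact: (weq_comp aX wc2 (weqI _ _ _ Ic1')).
split; last first.
  have [[_ [GP _] _] [_ [GD _] _]] := (s_tri Y CP, s_tri Y CD).
  apply: (stab_iso_weq GP.2 GD.2); apply: (weq_cancel (wj P CP)).
  rewrite (s_hat Y t CP CD); apply: (weq_comp aX wt); exact: wj.
split.
- by rewrite (s_hat Y f CM CN).
- rewrite /t -compA sq2 compA -(compA c1') c2g compA -(compA _ b2) b2b compA.
  by rewrite -(compA c1') -sq2' compA c1'c1 comp1m.
(* [ckappa T a1] is stably left invertible, so the third square may be checked after composing with
   it. *)
have [k kK] : exists k, stab_eq X (k \oc ckappa T a1) (idm _).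
  have [a1' [a1'a1 _]] := Ia1; exists (ckappa T a1').
  rewrite -(kappa_comp HR) // (kappa_stab_eq HR T CRM CRM a1'a1).
  exact: (kappa_id HR).
rewrite -[ckappa T (sj Y M) \oc x]comp1m -[x' \oc t]comp1m -kK -!compA.
suff -> : stab_eq X (ckappa T a1 \oc (ckappa T (sj Y M) \oc x))
  (ckappa T a1 \oc (x' \oc t)) by [].
rewrite compA -(kappa_comp HR) // -(kappa_stab_eq HR T CM CM1 a2a).
rewrite (kappa_comp HR) // -compA sq3 compA c2x.
by rewrite compA sq3' /t -!compA (compA c1) c1c1' comp1m.
Qed.

End Stabilizing.
End RightStructure.

(** * The zero adjunction and the compatibility axioms *)

Lemma zob_from (A : addCat) (N : ob A) (f g : hom (zob A) N) : f = g.
Proof. by rewrite (hom_from_null f) ?(hom_from_null g) ?idm_zob. Qed.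

Lemma zob_to (A : addCat) (N : ob A) (f g : hom N (zob A)) : f = g.
Proof. by rewrite (hom_to_null f) ?(hom_to_null g) ?idm_zob. Qed.

Definition zero_adjunction (A : addCat) : adjunction (zeroF A) (zeroF A) :=
  @Adjunction A (zeroF A) (zeroF A) (fun _ _ _ => 0) (fun _ _ _ => 0)
    (fun _ _ _ => zob_from _ _) (fun _ _ _ => zob_to _ _)
    (fun _ _ _ _ _ _ _ => zob_to _ _).

Theorem theorem6p4 (A : addCat) (E : conflations A) (hE : exact_structure E)
    (C W F : set (ob A)) (hH : hovey_triple E C W F) :
  localization_triple C (C `&` W `&` F) F /\
  pre_partial_triangulated (confl_left E F) (confl_right E C)
    F C (C `&` W `&` F).
Proof.
have hS M : idm (zeroF A M) = 0 := idm_zob A.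
have [hEop hHop] := (exact_op hE, hovey_op hE hH).
split; first exact: (localization_hovey hE hH).
split.
- exact: (partial_right_confl hE hH hS).
- rewrite -(dual_core C W F).
  exact: (@partial_right_confl _ _ hEop _ _ _ hHop (opF (zeroF A)) hS).
- exact: (stabilizing_confl hE hH hS).
- rewrite -(dual_core C W F) (setIC C F).
  exact: (@stabilizing_confl _ _ hEop _ _ _ hHop (opF (zeroF A)) hS).
exists (zero_adjunction A); split.
(* Condition (c) is the universal property of kernels and cokernels; the sign conditions are
   equations between maps from or to the zero object. *)
- move=> M N P f g h K' M' N' u v w b [Ef CP] _ [Ew FK] _.
  split=> [c sq | a sq].
    have [|a def_a] := kernel_lift (m := b \oc f) (confl_ker hE Ew).
      by rewrite compA -sq -compA (proj1 (confl_coker hE Ef)) compm0.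
    by exists a; split; [rewrite def_a | apply: zob_from].
  have [|c def_c] := cokernel_lift (m := w \oc b) (confl_coker hE Ef).
    by rewrite -compA -sq compA (proj1 (confl_ker hE Ew)) comp0m.
  by exists c; split; [rewrite def_c | apply: zob_to].
- move=> TR M CM FM K' M' N' u v w a b c [Ew FK] _ sq1 sq2 _ [e def_c].
  have [[Ei _] _] := c_tri TR CM.
  have Kv := confl_ker hE Ew.
  (* With [c] equal to [w \oc e], the map [b - e \oc cp TR M] is killed by [w]; its factor through
     [v] extends [a]. *)
  have [|k def_k] := kernel_lift (m := b - e \oc cp TR M) Kv.
    by rewrite compBr sq2 def_c compA subrr.
  exists k; apply: (kernel_mono Kv).
  by rewrite compA -def_k compBl -compA (proj1 (confl_ker hE Ei)) compm0 subr0.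
move=> TL D CD FD M N P f g h a b c [Ef CP] _ sq1 sq2 _ [e def_a].
have [[Ei _] _] := c_tri TL FD.
have Kg := confl_coker hE Ef.
(* Dually, subtracting the contribution of [e] makes [b] kill [f], and the descended map lifts
   [c]. *)
have [|k def_k] := cokernel_lift (m := b - l_iota TL D \oc e) Kg.
  by rewrite compBl -sq1 def_a compA subrr.
exists k; apply: (cokernel_epi Kg).
rewrite -compA -def_k compBr -sq2 compA.
have [pi0 _] : is_kernel (l_iota TL D) (l_pi TL D) by apply: confl_ker Ei.
by rewrite pi0 comp0m subr0.
Qed.
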